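(* Consider the boundary value problem (P) described in the context, and suppose in addition that: (a) the derivatives $q'(x)$ and $\Delta''(x)$ exist and are bounded in $[0,h_1)\cup(h_1,h_2)\cup(h_2,\pi]$ and have finite one-sided limits $q'(h_i\pm0)=\lim_{x\to h_i\pm0}q'(x)$ and $\Delta''(h_i\pm0)=\lim_{x\to h_i\pm0}\Delta''(x)$ for $i=1,2$; (b) $\Delta'(x)\le 1$ in $[0,h_1)\cup(h_1,h_2)\cup(h_2,\pi]$, $\Delta(0)=0$, $\lim_{x\to h_1+0}\Delta(x)=0$ and $\lim_{x\to h_2+0}\Delta(x)=0$. For all sufficiently large natural numbers $N$ let $\mu_N$ be the unique eigenvalue of (P) with $|N+\frac14-\mu_N|<\frac14$. Then, as $N\to\infty$, $$\mu_N=N+\frac14-\frac{2}{\pi(4N+1)}\left(2+\int_0^{\pi}q(\tau)\cos\left(\left(N+\tfrac14\right)\Delta(\tau)\right)d\tau\right)+O\left(\frac1{N^2}\right).$$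
   Context: Let $0<h_1<h_2<\pi$ and let $\delta,\theta$ be nonzero real numbers. Let $q$ be real-valued and $\Delta\ge 0$ real-valued on $[0,h_1)\cup(h_1,h_2)\cup(h_2,\pi]$, both continuous there with finite one-sided limits $q(h_i\pm0)$, $\Delta(h_i\pm0)$, $i=1,2$. Assume $x-\Delta(x)\ge 0$ for $x\in[0,h_1)$, $x-\Delta(x)\ge h_1$ for $x\in(h_1,h_2)$, and $x-\Delta(x)\ge h_2$ for $x\in(h_2,\pi)$. Let $\mu$ be a real positive parameter. Problem (P) is the differential equation with retarded argument $$y''(x)+q(x)y(x-\Delta(x))+\mu^2y(x)=0,\qquad x\in[0,h_1)\cup(h_1,h_2)\cup(h_2,\pi],$$ with boundary conditions $\mu y(0)+y'(0)=0$, $\mu^2y(\pi)+y'(\pi)=0$, and transmission conditions $y(h_1-0)=\delta y(h_1+0)$, $y'(h_1-0)=\delta y'(h_1+0)$, $y(h_2-0)=\theta y(h_2+0)$, $y'(h_2-0)=\theta y'(h_2+0)$. On each of the three pieces, $y$ and the data are extended to the closed interval by one-sided limits, so that $y(x-\Delta(x))$ is always evaluated on the same closed piece that contains $x$. An eigenvalue of (P) is a value $\mu>0$ for which (P) has a nontrivial solution. For each sufficiently large natural number $N$ there is exactly one eigenvalue $\mu$ with $|N+\frac14-\mu|<\frac14$; it is this eigenvalue that is denoted $\mu_N$. *)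

(* Defs.v *)
From Stdlib Require Import Reals.
From Coquelicot Require Import Coquelicot.
Open Scope R_scope.

(* Functions on [0,h1) U (h1,h2) U (h2,PI] are total functions R -> R; their
   values outside this set are never used.  Derivatives and continuity are
   taken relative to this set with the standard library's [D_in] and
   [continue_in]: two-sided at interior points, one-sided at 0 and PI. *)
Definition dom (h1 h2 x : R) : Prop :=
  (0 <= x < h1) \/ (h1 < x < h2) \/ (h2 < x <= PI).

Definition left_lim (f : R -> R) (a l : R) : Prop :=
  limit1_in f (fun x => x < a) l a.

Definition right_lim (f : R -> R) (a l : R) : Prop :=
  limit1_in f (fun x => a < x) l a.

Definition has_one_sided_lims (f : R -> R) (a : R) : Prop :=
  (exists l, left_lim f a l) /\ (exists r, right_lim f a r).

Definition bounded_on (D : R -> Prop) (f : R -> R) : Prop :=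
  exists M, forall x, D x -> Rabs (f x) <= M.

(* f(a-0) = c f(a+0), both limits existing and finite *)
Definition transmits (f : R -> R) (a c : R) : Prop :=
  exists l r, left_lim f a l /\ right_lim f a r /\ l = c * r.

(* Y is y with the values y(h1+0), y(h2+0) put at h1, h2.  For x in the domain,
   x - Delta x lies in the closed piece containing x and is at most x, so it can
   meet h1 or h2 only as the left endpoint of that piece; hence Y (x - Delta x)
   is y (x - Delta x) for the extension of y to that closed piece. *)
Definition is_right_ext (h1 h2 : R) (y Y : R -> R) : Prop :=
  (forall t, t <> h1 -> t <> h2 -> Y t = y t) /\
  right_lim y h1 (Y h1) /\ right_lim y h2 (Y h2).

Definition is_solution (h1 h2 delta theta : R) (q Delta : R -> R) (mu : R)
    (y : R -> R) : Prop :=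
  exists Y dy ddy : R -> R,
    is_right_ext h1 h2 y Y /\
    (forall x, dom h1 h2 x -> D_in y dy (dom h1 h2) x) /\
    (forall x, dom h1 h2 x -> D_in dy ddy (dom h1 h2) x) /\
    (forall x, dom h1 h2 x ->
       ddy x + q x * Y (x - Delta x) + mu ^ 2 * y x = 0) /\
    mu * y 0 + dy 0 = 0 /\
    mu ^ 2 * y PI + dy PI = 0 /\
    transmits y h1 delta /\ transmits dy h1 delta /\
    transmits y h2 theta /\ transmits dy h2 theta.

Definition is_eigenvalue (h1 h2 delta theta : R) (q Delta : R -> R)
    (mu : R) : Prop :=
  0 < mu /\
  exists y, is_solution h1 h2 delta theta q Delta mu y /\
            exists x, dom h1 h2 x /\ y x <> 0.

(* Main.v *)
(* Multiplying y by 1, delta, delta * theta on the three pieces gives a C^1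
   function z with z'' + q z(x - Delta) + mu^2 z = 0, so delta and theta play no
   role; normalize z(0) = 1.  The derivative of
   z(t) cos(mu t + k) - z'(t) sin(mu t + k) / mu  is
   q(t) z(t - Delta(t)) sin(mu t + k) / mu, which shows first that
   z(t) = cos(mu t) - sin(mu t) + O(1/mu) and then, inserting this approximation
   with k = - mu PI, that with c = cos(mu PI), s = sin(mu PI), the condition at PI reads
   c - s = (s + c) (1 + J / 2) / mu + O(1/mu^2),  J = int_0^PI q cos(mu Delta).
   The terms of phase mu (2 x - Delta) are O(1/mu) because 2 - Delta' >= 1.  As q'
   and Delta'' need not be Riemann integrable, integration by parts is replaced
   by the mean value inequality.  For mu = N + 1/4 + v the condition becomes
   tan(PI v) = - (1 + J / 2) / mu + O(1/mu^2), whence the expansion of v. *)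
Require Import Defs.
From Stdlib Require Import Reals Lra.
From Coquelicot Require Import Coquelicot.
Open Scope R_scope.


(** * One-sided limits and continuity on the pieces *)

Lemma limit1_in_local (f : R -> R) (D D' : R -> Prop) (l a eta : R) :
  0 < eta -> (forall x, Rabs (x - a) < eta -> D' x -> D x) ->
  limit1_in f D l a -> limit1_in f D' l a.
Proof.
  intros eta_pos HD H eps eps_pos.
  destruct (H eps eps_pos) as [alp [alp_pos Halp]].
  exists (Rmin alp eta). split; [apply Rmin_pos; assumption|].
  intros x [Dx dx]. simpl in dx. unfold Rdist in dx.
  apply Halp. split.
  - apply HD; [|exact Dx]. eapply Rlt_le_trans; [exact dx|apply Rmin_r].
  - simpl. unfold Rdist. eapply Rlt_le_trans; [exact dx|apply Rmin_l].
Qed.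

Lemma filterlim_limit1_in (f : R -> R) (D : R -> Prop) (l a : R) :
  limit1_in f D l a -> filterlim f (within D (locally a)) (locally l).
Proof.
  intros H. apply filterlim_locally. intros eps.
  destruct (H eps (cond_pos eps)) as [alp [alp_pos Halp]].
  exists (mkposreal alp alp_pos). intros x dx Dx.
  exact (Halp x (conj Dx dx)).
Qed.

Lemma right_lim_unique (f : R -> R) (a l l' : R) :
  right_lim f a l -> right_lim f a l' -> l = l'.
Proof.
  apply single_limit. intros alp alp_pos.
  exists (a + alp / 2). split; [lra|]. unfold Rdist.
  rewrite Rabs_right; lra.
Qed.

Lemma continuous_extension (f : R -> R) (a b la lb : R) :
  a < b -> (forall x, a < x < b -> continuity_pt f x) ->
  right_lim f a la -> left_lim f b lb ->
  exists g, continuity g /\ (forall x, a < x < b -> g x = f x) /\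
    g a = la /\ g b = lb.
Proof.
  intros ab fc fa fb.
  destruct (C0_extension_lt f la lb a b ab) as [g [gc [gf [ga gb]]]].
  - intros x Hx. apply continuity_pt_filterlim. auto.
  - apply filterlim_limit1_in, fa.
  - apply filterlim_limit1_in, fb.
  - exists g. repeat split; auto.
    intros x. apply continuity_pt_filterlim. apply gc.
Qed.

(** With [0] and [PI] left out, every point has a full neighbourhood inside the set, so continuity
    and derivatives relative to [dom] become the two-sided [continuity_pt] and [is_derive]. *)
Definition pieces (h1 h2 x : R) : Prop :=
  0 < x < h1 \/ h1 < x < h2 \/ h2 < x < PI.

Lemma pieces_dom (h1 h2 x : R) : pieces h1 h2 x -> dom h1 h2 x.
Proof. unfold pieces, dom. lra. Qed.

Lemma pieces_locally (h1 h2 x : R) :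
  pieces h1 h2 x ->
  exists eta, 0 < eta /\ forall t, Rabs (t - x) < eta -> pieces h1 h2 t.
Proof.
  assert (K : forall a b, a < x < b -> exists eta, 0 < eta /\
    forall t, Rabs (t - x) < eta -> a < t < b).
  { intros a b Hx. exists (Rmin (x - a) (b - x)).
    split; [apply Rmin_pos; lra|].
    intros t Ht. pose proof (Rmin_l (x - a) (b - x)).
    pose proof (Rmin_r (x - a) (b - x)). apply Rabs_def2 in Ht. lra. }
  intros [H | [H | H]]; destruct (K _ _ H) as [eta [eta_pos He]];
    exists eta; (split; [exact eta_pos|]); intros t Ht; specialize (He t Ht);
    unfold pieces; tauto.
Qed.

Lemma continue_in_pieces (h1 h2 : R) (f : R -> R) (x : R) :
  continue_in f (dom h1 h2) x -> pieces h1 h2 x -> continuity_pt f x.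
Proof.
  intros H Hx. destruct (pieces_locally _ _ _ Hx) as [eta [eta_pos He]].
  apply (limit1_in_local f (D_x (dom h1 h2) x)) with eta; auto.
  intros t Ht [_ Hne]. split; [apply pieces_dom, He, Ht | exact Hne].
Qed.

Lemma D_in_pieces (h1 h2 : R) (f df : R -> R) (x : R) :
  D_in f df (dom h1 h2) x -> pieces h1 h2 x -> is_derive f x (df x).
Proof.
  intros H Hx. destruct (pieces_locally _ _ _ Hx) as [eta [eta_pos He]].
  apply is_derive_Reals, derivable_pt_lim_D_in.
  apply (limit1_in_local _ (D_x (dom h1 h2) x)) with eta; auto.
  intros t Ht [_ Hne]. split; [apply pieces_dom, He, Ht | exact Hne].
Qed.

(** Each piece gets its own function continuous on the whole line, so that integrability and
    boundedness of continuous functions become available although [f] may jump at [h1] and [h2]. *)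
Lemma piecewise_extension (h1 h2 : R) (f : R -> R) (l1 r1 l2 r2 : R) :
  0 < h1 < h2 -> h2 < PI ->
  (forall x, dom h1 h2 x -> continue_in f (dom h1 h2) x) ->
  left_lim f h1 l1 -> right_lim f h1 r1 ->
  left_lim f h2 l2 -> right_lim f h2 r2 ->
  exists g1 g2 g3,
    (continuity g1 /\ g1 h1 = l1 /\ forall x, 0 <= x < h1 -> g1 x = f x) /\
    (continuity g2 /\ g2 h1 = r1 /\ g2 h2 = l2 /\
       forall x, h1 < x < h2 -> g2 x = f x) /\
    (continuity g3 /\ g3 h2 = r2 /\ forall x, h2 < x <= PI -> g3 x = f x).
Proof.
  intros Hh HP fc L1 R1 L2 R2.
  assert (fp : forall x, pieces h1 h2 x -> continuity_pt f x).
  { intros x Hx. apply continue_in_pieces with h1 h2; auto.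
    apply fc, pieces_dom, Hx. }
  destruct (continuous_extension f 0 h1 (f 0) l1) as [g1 [c1 [e1 [a1 b1]]]];
    [lra | intros x Hx; apply fp; left; lra | | exact L1 | ].
  (* The domain lies to the right of [0], so continuity relative to it is the right limit there;
     [PI] is treated symmetrically below. *)
  { apply (limit1_in_local f (D_x (dom h1 h2) 0)) with h1; [lra| |].
    - intros x Hx Hx'. apply Rabs_def2 in Hx. split; [left|]; lra.
    - apply fc. left. lra. }
  destruct (continuous_extension f h1 h2 r1 l2) as [g2 [c2 [e2 [a2 b2]]]];
    [lra | intros x Hx; apply fp; right; left; lra | exact R1 | exact L2 | ].
  destruct (continuous_extension f h2 PI r2 (f PI)) as [g3 [c3 [e3 [a3 b3]]]];
    [lra | intros x Hx; apply fp; right; right; lra | exact R2 | | ].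
  { apply (limit1_in_local f (D_x (dom h1 h2) PI)) with (PI - h2); [lra| |].
    - intros x Hx Hx'. apply Rabs_def2 in Hx. split; [right; right|]; lra.
    - apply fc. right. right. lra. }
  exists g1, g2, g3. repeat split; auto.
  - intros x Hx. destruct (Req_dec x 0) as [->|]; [exact a1 | apply e1; lra].
  - intros x Hx. destruct (Req_dec x PI) as [->|]; [exact b3 | apply e3; lra].
Qed.

(** * Gluing across [h1] and [h2] *)

Lemma continuity_Rmin_l (a : R) : continuity (fun x => Rmin x a).
Proof.
  assert (H : continuity (fun x => (x + a - Rabs (x - a)) / 2)).
  { intros x. apply continuity_pt_filterlim.
    apply (continuous_mult (fun x => x + a - Rabs (x - a)) (fun _ => / 2));
      [|apply continuous_const].
    apply (continuous_minus (fun x => x + a) (fun x => Rabs (x - a))).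
    - apply (continuous_plus (fun x => x) (fun _ => a));
        [apply continuous_id | apply continuous_const].
    - apply continuous_Rabs_comp.
      apply (continuous_minus (fun x => x) (fun _ => a));
        [apply continuous_id | apply continuous_const]. }
  intros x. apply continuity_pt_ext with (2 := H x). intros t.
  unfold Rmin, Rabs. destruct (Rle_dec t a), (Rcase_abs (t - a)); lra.
Qed.

Lemma continuity_Rmax_l (a : R) : continuity (fun x => Rmax x a).
Proof.
  intros x. apply continuity_pt_ext with (fun x => x + a - Rmin x a).
  - intros t. unfold Rmin, Rmax. destruct (Rle_dec t a); lra.
  - apply (continuity_pt_minus (fun x => x + a) (fun x => Rmin x a));
      [|apply continuity_Rmin_l].
    apply (continuity_pt_plus (fun x => x) (fun _ => a)).
    + apply derivable_continuous_pt, derivable_pt_id.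
    + apply continuity_pt_const. intros ? ?. reflexivity.
Qed.

(** Each summand is composed with the projection onto its own interval and is therefore constant
    outside it. The sum starts as [g1] and then follows the increments of [g2] and [g3], whatever
    their values at the break points. *)
Lemma glue (h1 h2 : R) (g1 g2 g3 : R -> R) :
  h1 < h2 -> continuity g1 -> continuity g2 -> continuity g3 ->
  exists F, continuity F /\
    (forall x, x <= h1 -> F x = g1 x) /\
    (forall x, h1 <= x <= h2 -> F x = F h1 + (g2 x - g2 h1)) /\
    (forall x, h2 <= x -> F x = F h2 + (g3 x - g3 h2)).
Proof.
  intros Hh c1 c2 c3.
  assert (E : forall x, h1 <= x -> Rmin x h1 = h1)
    by (intros; apply Rmin_right; auto).
  assert (E' : forall x, x <= h2 -> Rmax x h2 = h2)
    by (intros; apply Rmax_right; auto).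
  exists (fun x => g1 (Rmin x h1) + (g2 (Rmin (Rmax x h1) h2) - g2 h1)
                   + (g3 (Rmax x h2) - g3 h2)).
  repeat split.
  - intros x.
    apply (continuity_pt_plus (fun x => g1 (Rmin x h1)
             + (g2 (Rmin (Rmax x h1) h2) - g2 h1))
            (fun x => g3 (Rmax x h2) - g3 h2)).
    + apply (continuity_pt_plus (fun x => g1 (Rmin x h1))
              (fun x => g2 (Rmin (Rmax x h1) h2) - g2 h1)).
      * apply (continuity_pt_comp (fun x => Rmin x h1) g1);
          [apply continuity_Rmin_l | apply c1].
      * apply (continuity_pt_minus (fun x => g2 (Rmin (Rmax x h1) h2))
                (fun _ => g2 h1));
          [|apply continuity_pt_const; intros ? ?; reflexivity].
        apply (continuity_pt_comp (fun x => Rmin (Rmax x h1) h2) g2);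
          [|apply c2].
        apply (continuity_pt_comp (fun x => Rmax x h1) (fun x => Rmin x h2));
          [apply continuity_Rmax_l | apply continuity_Rmin_l].
    + apply (continuity_pt_minus (fun x => g3 (Rmax x h2)) (fun _ => g3 h2));
          [|apply continuity_pt_const; intros ? ?; reflexivity].
      apply (continuity_pt_comp (fun x => Rmax x h2) g3);
        [apply continuity_Rmax_l | apply c3].
  - intros x Hx. rewrite (Rmin_left x h1), (Rmax_right x h1), E' by lra.
    rewrite (Rmin_left h1 h2) by lra. ring.
  - intros x Hx. rewrite !E, !E' by lra.
    rewrite (Rmax_left x h1), (Rmax_left h1 h1) by lra.
    rewrite (Rmin_left x h2), (Rmin_left h1 h2) by lra. ring.
  - intros x Hx. rewrite !E by lra.
    rewrite (Rmax_left x h1), (Rmax_left h2 h1), (Rmax_left x h2),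
      (Rmax_left h2 h2) by lra.
    rewrite (Rmin_right x h2), (Rmin_left h2 h2) by lra. ring.
Qed.

(** The factors accumulate from left to right: [l1 = d1 * r1] makes [d1 * f] continue [f] past [h1],
    and [l2 = d2 * r2] repeats this at [h2]. The values at [h1] and [h2] are recorded because a
    retarded argument may hit these points. *)
Lemma transmission_glue (h1 h2 d1 d2 : R) (f : R -> R) :
  0 < h1 < h2 -> h2 < PI ->
  (forall x, dom h1 h2 x -> continue_in f (dom h1 h2) x) ->
  transmits f h1 d1 -> transmits f h2 d2 ->
  exists F, continuity F /\
    (forall x, 0 <= x < h1 -> F x = f x) /\
    (forall x, h1 < x < h2 -> F x = d1 * f x) /\
    (forall x, h2 < x <= PI -> F x = d1 * d2 * f x) /\
    (forall r, right_lim f h1 r -> F h1 = d1 * r) /\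
    (forall r, right_lim f h2 r -> F h2 = d1 * d2 * r).
Proof.
  intros Hh HP fc [l1 [r1 [L1 [R1 E1]]]] [l2 [r2 [L2 [R2 E2]]]].
  destruct (piecewise_extension h1 h2 f l1 r1 l2 r2 Hh HP fc L1 R1 L2 R2)
    as [g1 [g2 [g3 [[c1 [a1 e1]] [[c2 [a2 [b2 e2]]] [c3 [a3 e3]]]]]]].
  destruct (glue h1 h2 g1 (fun x => d1 * g2 x) (fun x => d1 * d2 * g3 x))
    as [F [Fc [F1 [F2 F3]]]].
  - lra.
  - exact c1.
  - intros x. apply (continuity_pt_scal g2). apply c2.
  - intros x. apply (continuity_pt_scal g3). apply c3.
  - assert (Fh1 : F h1 = d1 * r1) by (rewrite F1; lra).
    assert (Fh2 : F h2 = d1 * d2 * r2).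
    { rewrite F2, Fh1, a2, b2, E2 by lra. ring. }
    exists F. repeat split; auto.
    + intros x Hx. rewrite F1, e1 by lra. reflexivity.
    + intros x Hx. rewrite F2, Fh1, a2, e2 by lra. ring.
    + intros x Hx. rewrite F3, Fh2, a3, e3 by lra. ring.
    + intros r Hr. rewrite (right_lim_unique _ _ _ _ Hr R1). exact Fh1.
    + intros r Hr. rewrite (right_lim_unique _ _ _ _ Hr R2). exact Fh2.
Qed.

(** * Antiderivatives of piecewise continuous functions *)

Lemma is_derive_RInt_upper (g : R -> R) (a : R) :
  continuity g -> forall x, is_derive (fun x => RInt g a x) x (g x).
Proof.
  intros gc x. apply is_derive_RInt with a.
  - apply filter_forall. intros b. apply (RInt_correct g).
    apply ex_RInt_continuous. intros z _. apply continuity_pt_filterlim, gc.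
  - apply continuity_pt_filterlim, gc.
Qed.

Lemma is_derive_continuity (f df : R -> R) :
  (forall x, is_derive f x (df x)) -> continuity f.
Proof.
  intros H x. apply continuity_pt_filterlim.
  apply (ex_derive_continuous f). exists (df x). apply H.
Qed.

Lemma is_derive_ext_interval (f g : R -> R) (a b x l : R) :
  a < x < b -> (forall t, a < t < b -> f t = g t) ->
  is_derive f x l -> is_derive g x l.
Proof.
  intros Hx H. apply is_derive_ext_loc.
  assert (e : 0 < Rmin (x - a) (b - x)) by (apply Rmin_pos; lra).
  exists (mkposreal _ e). intros t Ht.
  apply H. change (Rabs (t - x) < Rmin (x - a) (b - x)) in Ht.
  pose proof (Rmin_l (x - a) (b - x)). pose proof (Rmin_r (x - a) (b - x)).
  apply Rabs_def2 in Ht. lra.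
Qed.

Lemma is_derive_const_plus (f : R -> R) (c x l : R) :
  is_derive f x l -> is_derive (fun t => c + f t) x l.
Proof.
  intros H. rewrite <- (Rplus_0_l l).
  apply (is_derive_plus (fun _ => c) f x 0 l); [|exact H].
  exact (@is_derive_const R_AbsRing R_NormedModule c x).
Qed.

(** The glued integrals of the three extensions stay continuous across the jumps of [f]. The
    integral of the theorem can thus be treated as a function with a known derivative on [pieces],
    accessible to mean value inequalities, and is identified with [RInt] at [PI]. *)
Lemma piecewise_antiderivative (h1 h2 : R) (f : R -> R) :
  0 < h1 < h2 -> h2 < PI ->
  (forall x, dom h1 h2 x -> continue_in f (dom h1 h2) x) ->
  has_one_sided_lims f h1 -> has_one_sided_lims f h2 ->
  exists F, continuity F /\
    (forall x, pieces h1 h2 x -> is_derive F x (f x)) /\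
    F 0 = 0 /\ F PI = RInt f 0 PI.
Proof.
  intros Hh HP fc [[l1 L1] [r1 R1]] [[l2 L2] [r2 R2]].
  destruct (piecewise_extension h1 h2 f l1 r1 l2 r2 Hh HP fc L1 R1 L2 R2)
    as [g1 [g2 [g3 [[c1 [a1 e1]] [[c2 [a2 [b2 e2]]] [c3 [a3 e3]]]]]]].
  assert (D1 := is_derive_RInt_upper g1 0 c1).
  assert (D2 := is_derive_RInt_upper g2 h1 c2).
  assert (D3 := is_derive_RInt_upper g3 h2 c3).
  assert (I : forall g a b, continuity g -> ex_RInt g a b).
  { intros g a b gc. apply (ex_RInt_continuous g).
    intros z _. apply continuity_pt_filterlim, gc. }
  destruct (glue h1 h2 (RInt g1 0) (RInt g2 h1) (RInt g3 h2))
    as [F [Fc [F1 [F2 F3]]]];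
    [lra | eapply is_derive_continuity; eauto ..|].
  exists F. split; [exact Fc|]. split; [|split].
  - intros x [Hx | [Hx | Hx]].
    + rewrite <- e1 by lra.
      apply (is_derive_ext_interval (RInt g1 0) F 0 h1); auto.
      intros t Ht. rewrite F1 by lra. reflexivity.
    + rewrite <- e2 by lra.
      apply (is_derive_ext_interval
        (fun t => (F h1 - RInt g2 h1 h1) + RInt g2 h1 t) F h1 h2); auto.
      * intros t Ht. rewrite (F2 t) by lra. ring.
      * apply is_derive_const_plus, D2.
    + rewrite <- e3 by lra.
      apply (is_derive_ext_interval
        (fun t => (F h2 - RInt g3 h2 h2) + RInt g3 h2 t) F h2 PI); auto.
      * intros t Ht. rewrite (F3 t) by lra. ring.
      * apply is_derive_const_plus, D3.
  - rewrite F1 by lra. apply (RInt_point 0 g1).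
  (* Integrands are compared on open intervals only, so the arbitrary values of [f] at [h1] and [h2]
     do not matter. *)
  - assert (X1 : ex_RInt f 0 h1).
    { apply (ex_RInt_ext g1); [|apply I, c1].
      rewrite Rmin_left, Rmax_right by lra. intros x Hx. apply e1. lra. }
    assert (X2 : ex_RInt f h1 h2).
    { apply (ex_RInt_ext g2); [|apply I, c2].
      rewrite Rmin_left, Rmax_right by lra. intros x Hx. apply e2. lra. }
    assert (X3 : ex_RInt f h2 PI).
    { apply (ex_RInt_ext g3); [|apply I, c3].
      rewrite Rmin_left, Rmax_right by lra. intros x Hx. apply e3. lra. }
    rewrite F3, F2, F1 by lra.
    rewrite (RInt_point h1 g2), (RInt_point h2 g3).
    rewrite <- (RInt_Chasles f 0 h2 PI); [|apply ex_RInt_Chasles with h1; auto|auto].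
    rewrite <- (RInt_Chasles f 0 h1 h2) by auto.
    rewrite (RInt_ext f g1 0 h1), (RInt_ext f g2 h1 h2), (RInt_ext f g3 h2 PI).
    + unfold zero, plus; simpl. ring.
    + rewrite Rmin_left, Rmax_right by lra. intros x Hx. symmetry. apply e3. lra.
    + rewrite Rmin_left, Rmax_right by lra. intros x Hx. symmetry. apply e2. lra.
    + rewrite Rmin_left, Rmax_right by lra. intros x Hx. symmetry. apply e1. lra.
Qed.


(** * Mean value inequalities across the break points *)

(** This replaces integration by parts: [V] is the boundary term, which is small but may lack limits
    at [a] and [b]. The mean value theorem is applied to [U + V] slightly inside the interval;
    continuity of [U] then reaches the endpoints, and the two values of [V] cost [2 * B]. *)
Lemma increment_bound_interval (a b B K : R) (U V : R -> R) :
  a < b -> continuity U ->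
  (forall x, a < x < b -> Rabs (V x) <= B) ->
  (forall x, a < x < b ->
     exists d, is_derive (fun t => U t + V t) x d /\ Rabs d <= K) ->
  Rabs (U b - U a) <= 2 * B + K * (b - a).
Proof.
  intros ab Uc VB HD.
  apply le_epsilon. intros eps eps_pos.
  destruct (Uc a (eps / 2)) as [ra [ra_pos Ha]]; [lra|].
  destruct (Uc b (eps / 2)) as [rb [rb_pos Hb]]; [lra|].
  (* A third of the minimum keeps [m] strictly below both radii and [a + m] below [b - m]. *)
  set (m := Rmin (Rmin ra rb) (b - a) / 3).
  assert (m_pos : 0 < m).
  { unfold m. apply Rdiv_lt_0_compat; [|lra].
    apply Rmin_pos; [apply Rmin_pos|]; lra. }
  assert (m_ra : m < ra /\ m < rb /\ 3 * m <= b - a).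
  { pose proof (Rmin_l (Rmin ra rb) (b - a)). pose proof (Rmin_r (Rmin ra rb) (b - a)).
    pose proof (Rmin_l ra rb). pose proof (Rmin_r ra rb). unfold m in *. lra. }
  assert (Ua : Rabs (U (a + m) - U a) < eps / 2).
  { apply (Ha (a + m)). split.
    - split; [exact I | lra].
    - simpl. unfold Rdist. rewrite Rabs_right; lra. }
  assert (Ub : Rabs (U (b - m) - U b) < eps / 2).
  { apply (Hb (b - m)). split.
    - split; [exact I | lra].
    - simpl. unfold Rdist. rewrite Rabs_left; lra. }
  assert (exd : forall x, a < x < b -> ex_derive (fun t => U t + V t) x).
  { intros x Hx. destruct (HD x Hx) as [d [Hd _]]. exists d. exact Hd. }
  destruct (MVT_gen (fun t => U t + V t) (a + m) (b - m)
              (Derive (fun t => U t + V t))) as [c [Hc Ec]].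
  - rewrite Rmin_left, Rmax_right by lra. intros x Hx.
    apply Derive_correct, exd. lra.
  - rewrite Rmin_left, Rmax_right by lra. intros x Hx.
    apply continuity_pt_filterlim. apply (ex_derive_continuous (fun t => U t + V t)).
    apply exd. lra.
  - rewrite Rmin_left, Rmax_right in Hc by lra.
    destruct (HD c) as [d [Hd dK]]; [lra|].
    assert (Ed : Derive (fun t => U t + V t) c = d)
      by (apply is_derive_unique; exact Hd).
    rewrite Ed in Ec.
    assert (E : Rabs (d * (b - m - (a + m))) <= K * (b - a)).
    { rewrite Rabs_mult, (Rabs_right (b - m - (a + m))) by lra.
      apply Rmult_le_compat; try lra. apply Rabs_pos. }
    rewrite <- Ec in E.
    pose proof (VB (a + m) ltac:(lra)) as V1.
    pose proof (VB (b - m) ltac:(lra)) as V2.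
    apply Rabs_le_between in E, V1, V2. apply Rabs_def2 in Ua, Ub.
    apply Rabs_le. lra.
Qed.

(** The function [V] may jump at [h1] and [h2], so each of the three pieces contributes its own
    [2 * B]. *)
Lemma increment_bound (h1 h2 B K x : R) (U V : R -> R) :
  0 < h1 < h2 -> h2 < PI -> 0 <= B -> continuity U ->
  (forall x, pieces h1 h2 x -> Rabs (V x) <= B) ->
  (forall x, pieces h1 h2 x ->
     exists d, is_derive (fun t => U t + V t) x d /\ Rabs d <= K) ->
  0 <= x <= PI ->
  Rabs (U x - U 0) <= 6 * B + K * x.
Proof.
  intros Hh HP B_ge0 Uc VB HD Hx.
  assert (Step : forall a b, a <= b ->
            (forall t, a < t < b -> pieces h1 h2 t) ->
            Rabs (U b - U a) <= 2 * B + K * (b - a)).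
  { intros a b [ab | <-] Hp.
    - apply increment_bound_interval with V; auto.
    - rewrite !Rminus_diag, Rabs_R0. lra. }
  assert (S1 : forall x, 0 <= x <= h1 -> Rabs (U x - U 0) <= 2 * B + K * x).
  { intros t Ht. rewrite <- (Rminus_0_r t) at 2. apply Step; [lra|].
    intros s Hs. left. lra. }
  assert (S2 : forall x, h1 <= x <= h2 -> Rabs (U x - U h1) <= 2 * B + K * (x - h1)).
  { intros t Ht. apply Step; [lra|]. intros s Hs. right. left. lra. }
  assert (S3 : forall x, h2 <= x <= PI -> Rabs (U x - U h2) <= 2 * B + K * (x - h2)).
  { intros t Ht. apply Step; [lra|]. intros s Hs. right. right. lra. }
  pose proof (S1 h1 ltac:(lra)) as E1. pose proof (S2 h2 ltac:(lra)) as E2.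
  destruct (Rle_dec x h1) as [L1 | L1].
  { pose proof (S1 x ltac:(lra)). lra. }
  destruct (Rle_dec x h2) as [L2 | L2].
  { pose proof (S2 x ltac:(lra)) as E. apply Rabs_le_between in E, E1.
    apply Rabs_le. lra. }
  pose proof (S3 x ltac:(lra)) as E. apply Rabs_le_between in E, E1, E2.
  apply Rabs_le. lra.
Qed.

Lemma increment_bound_simple (h1 h2 K x : R) (U dU : R -> R) :
  0 < h1 < h2 -> h2 < PI -> continuity U ->
  (forall x, pieces h1 h2 x -> is_derive U x (dU x) /\ Rabs (dU x) <= K) ->
  0 <= x <= PI ->
  Rabs (U x - U 0) <= K * x.
Proof.
  intros Hh HP Uc HD Hx.
  replace (K * x) with (6 * 0 + K * x) by ring.
  apply increment_bound with h1 h2 (fun _ => 0); auto; try lra.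
  - intros. rewrite Rabs_R0. lra.
  - intros t Ht. destruct (HD t Ht) as [Hd Hk]. exists (dU t). split; [|exact Hk].
    apply is_derive_ext with (2 := Hd). intros s. symmetry. apply Rplus_0_r.
Qed.

(** * The reduced problem and a priori bounds *)

(** A single [K] bounds [q], [q'] and [Delta''], so that all later error constants can be chosen
    from [K] alone, before the index of the eigenvalue. *)
Record delay_data (h1 h2 K : R) (q Delta dq dDelta ddDelta : R -> R) : Prop := {
  dd_h : 0 < h1 < h2;
  dd_h2 : h2 < PI;
  dd_K : 0 <= K;
  dd_q : forall x, pieces h1 h2 x -> is_derive q x (dq x);
  dd_Delta : forall x, pieces h1 h2 x -> is_derive Delta x (dDelta x);
  dd_dDelta : forall x, pieces h1 h2 x -> is_derive dDelta x (ddDelta x);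
  dd_q_le : forall x, pieces h1 h2 x -> Rabs (q x) <= K;
  dd_dq_le : forall x, pieces h1 h2 x -> Rabs (dq x) <= K;
  dd_ddDelta_le : forall x, pieces h1 h2 x -> Rabs (ddDelta x) <= K;
  dd_dDelta_le1 : forall x, pieces h1 h2 x -> dDelta x <= 1;
  dd_Delta_ge0 : forall x, pieces h1 h2 x -> 0 <= Delta x;
  dd_retard : forall x, pieces h1 h2 x -> 0 <= x - Delta x
}.

(** Here the transmission factors have been absorbed into [z] and its slope [w]. Normalization at
    [0] is kept apart, so that the conditions remain linear and solutions can be rescaled. *)
Record reduced_solution (h1 h2 : R) (q Delta : R -> R) (mu : R)
    (z w : R -> R) : Prop := {
  rs_z_cont : continuity z;
  rs_w_cont : continuity w;
  rs_z : forall x, pieces h1 h2 x -> is_derive z x (w x);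
  rs_w : forall x, pieces h1 h2 x ->
    is_derive w x (- q x * z (x - Delta x) - mu ^ 2 * z x);
  rs_0 : w 0 = - mu * z 0;
  rs_PI : mu ^ 2 * z PI + w PI = 0
}.

Lemma is_derive_mult_R (f g : R -> R) (x df dg : R) :
  is_derive f x df -> is_derive g x dg ->
  is_derive (fun t => f t * g t) x (df * g x + f x * dg).
Proof.
  intros Hf Hg. apply (is_derive_mult f g x df dg Hf Hg).
  intros. apply Rmult_comm.
Qed.

(** The rotation is constant along solutions of the free equation [z'' + mu^2 z = 0], so only the
    retarded term survives, with a gain of [1 / mu]. *)
Lemma rotated_derive (h1 h2 mu k x : R) (q Delta z w : R -> R) :
  mu <> 0 -> reduced_solution h1 h2 q Delta mu z w -> pieces h1 h2 x ->
  is_derive (fun t => z t * cos (mu * t + k) - w t * (sin (mu * t + k) / mu)) x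
    (q x * z (x - Delta x) * sin (mu * x + k) / mu).
Proof.
  intros mu_neq0 S Hx.
  pose proof (rs_z _ _ _ _ _ _ _ S x Hx) as Hz.
  pose proof (rs_w _ _ _ _ _ _ _ S x Hx) as Hw.
  replace (q x * z (x - Delta x) * sin (mu * x + k) / mu) with
    ((w x * cos (mu * x + k) + z x * (- (mu * sin (mu * x + k)))) -
     ((- q x * z (x - Delta x) - mu ^ 2 * z x) * (sin (mu * x + k) / mu)
      + w x * (cos (mu * x + k)))) by (field; exact mu_neq0).
  apply (is_derive_minus
    (fun t => z t * cos (mu * t + k)) (fun t => w t * (sin (mu * t + k) / mu))).
  - apply (is_derive_mult_R z (fun t => cos (mu * t + k))); [exact Hz|].
    auto_derive; [exact I | ring].
  - apply (is_derive_mult_R w (fun t => sin (mu * t + k) / mu)); [exact Hw|].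
    auto_derive; [exact I | field; exact mu_neq0].
Qed.

(* For [k = - mu * t] the rotated quantity at [t] is [z t], and for
   [k = - mu * t - PI / 2] it is [w t / mu]: the increment bound then plays the
   role of the variation of constants formula. *)
Lemma rotated_increment (h1 h2 K mu k M t : R) (q Delta dq dDelta ddDelta z w : R -> R) :
  delay_data h1 h2 K q Delta dq dDelta ddDelta ->
  0 < mu -> reduced_solution h1 h2 q Delta mu z w ->
  (forall x, 0 <= x <= PI -> Rabs (z x) <= M) ->
  0 <= t <= PI ->
  Rabs (z t * cos (mu * t + k) - w t * (sin (mu * t + k) / mu)
        - z 0 * (cos k + sin k)) <= K * M * PI / mu.
Proof.
  intros D mu_pos S zM Ht.
  pose proof (dd_h _ _ _ _ _ _ _ _ D) as Hh.
  pose proof (dd_h2 _ _ _ _ _ _ _ _ D) as HP.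
  pose proof (dd_K _ _ _ _ _ _ _ _ D) as K_ge0.
  assert (M_ge0 : 0 <= M).
  { eapply Rle_trans; [apply Rabs_pos | apply (zM t Ht)]. }
  assert (KM : 0 <= K * M) by (apply Rmult_le_pos; auto).
  assert (imu : 0 < / mu) by (apply Rinv_0_lt_compat; auto).
  set (U := fun t => z t * cos (mu * t + k) - w t * (sin (mu * t + k) / mu)).
  replace (z 0 * (cos k + sin k)) with (U 0).
  2: { unfold U. rewrite (rs_0 _ _ _ _ _ _ _ S), Rmult_0_r, Rplus_0_l. field. lra. }
  apply Rle_trans with (K * M / mu * t).
  - apply (increment_bound_simple h1 h2 (K * M / mu) t U
      (fun x => q x * z (x - Delta x) * sin (mu * x + k) / mu)); auto.
    + intros x. apply continuity_pt_minus; apply continuity_pt_mult.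
      * apply (rs_z_cont _ _ _ _ _ _ _ S).
      * apply continuity_pt_filterlim.
        apply (ex_derive_continuous (fun x => cos (mu * x + k))).
        auto_derive. exact I.
      * apply (rs_w_cont _ _ _ _ _ _ _ S).
      * apply continuity_pt_filterlim.
        apply (ex_derive_continuous (fun x => sin (mu * x + k) / mu)).
        auto_derive. exact I.
    + intros x Hx. split.
      * apply (rotated_derive h1 h2); auto. lra.
      * unfold Rdiv. rewrite !Rabs_mult, (Rabs_right (/ mu)) by lra.
        apply Rmult_le_compat_r; [lra|].
        rewrite <- (Rmult_1_r (K * M)).
        apply Rmult_le_compat; try apply Rabs_pos.
        -- apply Rmult_le_pos; apply Rabs_pos.
        -- apply Rmult_le_compat; try apply Rabs_pos.
           ++ apply (dd_q_le _ _ _ _ _ _ _ _ D x Hx).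
           ++ apply zM. pose proof (dd_retard _ _ _ _ _ _ _ _ D x Hx).
              pose proof (dd_Delta_ge0 _ _ _ _ _ _ _ _ D x Hx).
              unfold pieces in Hx. lra.
        -- apply Rabs_le. pose proof (SIN_bound (mu * x + k)). lra.
  - replace (K * M * PI / mu) with (K * M / mu * PI) by (field; lra).
    apply Rmult_le_compat_l; [|lra].
    apply Rmult_le_pos; lra.
Qed.

Lemma solution_value (h1 h2 K mu M t : R) (q Delta dq dDelta ddDelta z w : R -> R) :
  delay_data h1 h2 K q Delta dq dDelta ddDelta ->
  0 < mu -> reduced_solution h1 h2 q Delta mu z w ->
  (forall x, 0 <= x <= PI -> Rabs (z x) <= M) ->
  0 <= t <= PI ->
  Rabs (z t - z 0 * (cos (mu * t) - sin (mu * t))) <= K * M * PI / mu.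
Proof.
  intros D mu_pos S zM Ht.
  pose proof (rotated_increment h1 h2 K mu (- (mu * t)) M t q Delta dq dDelta
    ddDelta z w D mu_pos S zM Ht) as H.
  rewrite Rplus_opp_r, cos_0, sin_0, cos_neg, sin_neg in H.
  replace (z t - z 0 * (cos (mu * t) - sin (mu * t))) with
    (z t * 1 - w t * (0 / mu) - z 0 * (cos (mu * t) + - sin (mu * t)))
    by (field; lra).
  exact H.
Qed.

Lemma solution_slope (h1 h2 K mu M t : R) (q Delta dq dDelta ddDelta z w : R -> R) :
  delay_data h1 h2 K q Delta dq dDelta ddDelta ->
  0 < mu -> reduced_solution h1 h2 q Delta mu z w ->
  (forall x, 0 <= x <= PI -> Rabs (z x) <= M) ->
  0 <= t <= PI ->
  Rabs (w t / mu + z 0 * (cos (mu * t) + sin (mu * t))) <= K * M * PI / mu.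
Proof.
  intros D mu_pos S zM Ht.
  pose proof (rotated_increment h1 h2 K mu (- (PI / 2 + mu * t)) M t q Delta dq
    dDelta ddDelta z w D mu_pos S zM Ht) as H.
  replace (mu * t + - (PI / 2 + mu * t)) with (- (PI / 2)) in H by ring.
  rewrite !cos_neg, !sin_neg, cos_PI2, sin_PI2 in H.
  rewrite <- cos_sin, cos_plus, cos_PI2, sin_PI2 in H.
  replace (w t / mu + z 0 * (cos (mu * t) + sin (mu * t))) with
    (z t * 0 - w t * (- (1) / mu) -
     z 0 * (0 * cos (mu * t) - 1 * sin (mu * t) + - cos (mu * t)))
    by (field; lra).
  exact H.
Qed.

(** At a maximum point [m] of [Rabs z], the estimate [solution_value] is used with the maximum
    itself as [M]. Its error is then at most half the maximum and is absorbed on the left; as the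
    free part is at most [2 * Rabs (z 0)], the factor [4] results. *)
Lemma solution_bound (h1 h2 K mu : R) (q Delta dq dDelta ddDelta z w : R -> R) :
  delay_data h1 h2 K q Delta dq dDelta ddDelta ->
  0 < mu -> 2 * (K * PI) <= mu ->
  reduced_solution h1 h2 q Delta mu z w ->
  forall x, 0 <= x <= PI -> Rabs (z x) <= 4 * Rabs (z 0).
Proof.
  intros D mu_pos mu_large S.
  destruct (continuity_ab_maj (fun x => Rabs (z x)) 0 PI) as [m [Hm Im]].
  - pose proof PI_RGT_0. lra.
  - intros x _. apply (continuity_pt_comp z Rabs);
      [apply (rs_z_cont _ _ _ _ _ _ _ S) | apply Rcontinuity_abs].
  - intros x Hx. apply Rle_trans with (1 := Hm x Hx). cbv beta.
    pose proof (solution_value h1 h2 K mu _ m q Delta dq dDelta ddDelta z w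
      D mu_pos S Hm Im) as H. cbv beta in H.
    assert (Hc : K * Rabs (z m) * PI / mu <= Rabs (z m) / 2).
    { apply (Rmult_le_reg_r mu); [exact mu_pos|].
      replace (K * Rabs (z m) * PI / mu * mu) with (K * PI * Rabs (z m))
        by (field; lra).
      replace (Rabs (z m) / 2 * mu) with (mu / 2 * Rabs (z m)) by field.
      apply Rmult_le_compat_r; [apply Rabs_pos | lra]. }
    assert (Hz : Rabs (z 0 * (cos (mu * m) - sin (mu * m))) <= 2 * Rabs (z 0)).
    { rewrite Rabs_mult, Rmult_comm. apply Rmult_le_compat_r; [apply Rabs_pos|].
      apply Rabs_le. pose proof (COS_bound (mu * m)). pose proof (SIN_bound (mu * m)).
      lra. }
    pose proof (Rabs_triang (z m - z 0 * (cos (mu * m) - sin (mu * m)))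
      (z 0 * (cos (mu * m) - sin (mu * m)))) as T.
    rewrite Rplus_comm, Rplus_minus in T. lra.
Qed.


(** * The oscillating phase and the characteristic equation *)

(** To be used with [a = mu * (x - Delta x)] and [b = mu * (x - PI)]: the difference
    [a - b = mu * (PI - Delta x)] produces the integral of the theorem, while the sum [a + b]
    oscillates fast. *)
Lemma phase_product (a b : R) :
  (cos a - sin a) * sin b =
  - / 2 * (sin (a - b) + cos (a - b)) + / 2 * (sin (a + b) + cos (a + b)).
Proof. rewrite sin_plus, cos_plus, sin_minus, cos_minus. field. Qed.

(* The phase [a + b = mu * (2 x - Delta x - PI)] is not stationary, since
   [2 - Delta' >= 1]: its contribution is the derivative of this quantity, up to
   lower order. *)
Definition oscillation (mu : R) (q Delta dDelta : R -> R) (x : R) : R :=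
  q x * / (2 - dDelta x) *
  (cos (mu * (PI - 2 * x + Delta x)) + sin (mu * (PI - 2 * x + Delta x))) / (2 * mu).

Lemma cos_plus_sin_bound (y : R) : Rabs (cos y + sin y) <= 2.
Proof.
  apply Rabs_le. pose proof (COS_bound y). pose proof (SIN_bound y). lra.
Qed.

Lemma oscillation_bound (h1 h2 K mu x : R) (q Delta dq dDelta ddDelta : R -> R) :
  delay_data h1 h2 K q Delta dq dDelta ddDelta -> 0 < mu -> pieces h1 h2 x ->
  Rabs (oscillation mu q Delta dDelta x) <= K / mu.
Proof.
  intros D mu_pos Hx.
  pose proof (dd_dDelta_le1 _ _ _ _ _ _ _ _ D x Hx) as Hp.
  pose proof (dd_q_le _ _ _ _ _ _ _ _ D x Hx) as Hq.
  assert (Hi : 0 < / (2 - dDelta x) <= 1).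
  { split; [apply Rinv_0_lt_compat; lra|]. rewrite <- Rinv_1.
    apply Rinv_le_contravar; lra. }
  unfold oscillation. set (y := mu * (PI - 2 * x + Delta x)).
  replace (K / mu) with (K * 1 * 2 * / (2 * mu)) by (field; lra).
  unfold Rdiv. rewrite !Rabs_mult, (Rabs_right (/ (2 * mu))).
  2: { apply Rle_ge, Rlt_le, Rinv_0_lt_compat. lra. }
  apply Rmult_le_compat_r; [apply Rlt_le, Rinv_0_lt_compat; lra|].
  apply Rmult_le_compat; [apply Rmult_le_pos; apply Rabs_pos|apply Rabs_pos| |
    apply cos_plus_sin_bound].
  apply Rmult_le_compat; try apply Rabs_pos; auto.
  rewrite Rabs_right; lra.
Qed.

(** Differentiating the phase brings out [- mu * (2 - dDelta x)], which cancels the denominators and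
    leaves the fast term. The remainder [e] comes from differentiating [q] and [/ (2 - dDelta)]; it
    keeps the factor [1 / mu] and is bounded since [2 - dDelta x >= 1]. *)
Lemma oscillation_derive (h1 h2 K mu x : R) (q Delta dq dDelta ddDelta : R -> R) :
  delay_data h1 h2 K q Delta dq dDelta ddDelta -> 0 < mu -> pieces h1 h2 x ->
  exists e, Rabs e <= (K + K * K) / mu /\
    is_derive (oscillation mu q Delta dDelta) x
      (e - / 2 * q x * (cos (mu * (PI - 2 * x + Delta x))
                        - sin (mu * (PI - 2 * x + Delta x)))).
Proof.
  intros D mu_pos Hx.
  pose proof (dd_dDelta_le1 _ _ _ _ _ _ _ _ D x Hx) as Hp.
  pose proof (dd_q_le _ _ _ _ _ _ _ _ D x Hx) as Hq.
  pose proof (dd_dq_le _ _ _ _ _ _ _ _ D x Hx) as Hdq.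
  pose proof (dd_ddDelta_le _ _ _ _ _ _ _ _ D x Hx) as HddD.
  pose proof (dd_K _ _ _ _ _ _ _ _ D) as K_ge0.
  pose proof (dd_q _ _ _ _ _ _ _ _ D x Hx) as Dq.
  pose proof (dd_Delta _ _ _ _ _ _ _ _ D x Hx) as DD.
  pose proof (dd_dDelta _ _ _ _ _ _ _ _ D x Hx) as DdD.
  set (p := 2 - dDelta x).
  assert (Hi : 0 < / p <= 1).
  { unfold p. split; [apply Rinv_0_lt_compat; lra|]. rewrite <- Rinv_1.
    apply Rinv_le_contravar; lra. }
  set (y := mu * (PI - 2 * x + Delta x)).
  exists ((dq x * / p + q x * ddDelta x * (/ p * / p)) * (cos y + sin y) * / (2 * mu)).
  split.
  - rewrite !Rabs_mult, (Rabs_right (/ (2 * mu))).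
    2: { apply Rle_ge, Rlt_le, Rinv_0_lt_compat. lra. }
    replace ((K + K * K) / mu) with ((K + K * K) * 2 * / (2 * mu)) by (field; lra).
    apply Rmult_le_compat_r; [apply Rlt_le, Rinv_0_lt_compat; lra|].
    apply Rmult_le_compat; try apply Rabs_pos; [|apply cos_plus_sin_bound].
    apply Rle_trans with (1 := Rabs_triang _ _).
    apply Rplus_le_compat; rewrite !Rabs_mult.
    + rewrite (Rabs_right (/ p)) by lra. rewrite <- (Rmult_1_r K).
      apply Rmult_le_compat; try apply Rabs_pos; lra.
    + rewrite (Rabs_right (/ p)) by lra. rewrite <- (Rmult_1_r (K * K)).
      apply Rmult_le_compat.
      * apply Rmult_le_pos; apply Rabs_pos.
      * apply Rmult_le_pos; lra.
      * apply Rmult_le_compat; try apply Rabs_pos; auto.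
      * rewrite <- (Rmult_1_r 1). apply Rmult_le_compat; lra.
  - unfold oscillation.
    assert (Hinv : is_derive (fun t => / (2 - dDelta t)) x (ddDelta x * (/ p * / p))).
    { replace (ddDelta x * (/ p * / p)) with
        (- (0 - ddDelta x) / (2 - dDelta x) ^ 2)
        by (unfold p; field; lra).
      apply (is_derive_inv (fun t => 2 - dDelta t) x (0 - ddDelta x)); [|lra].
      apply (is_derive_minus (fun _ => 2) dDelta); [|exact DdD].
      exact (@is_derive_const R_AbsRing R_NormedModule 2 x). }
    assert (Hy : is_derive (fun t => mu * (PI - 2 * t + Delta t)) x (- (mu * p))).
    { replace (- (mu * p)) with (mu * (- 2 + dDelta x)) by (unfold p; ring).
      apply (is_derive_scal (fun t => PI - 2 * t + Delta t) x mu (- 2 + dDelta x)).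
      apply (is_derive_plus (fun t => PI - 2 * t) Delta x (- 2) (dDelta x)); [|exact DD].
      auto_derive; [exact I | ring]. }
    assert (Hcs : is_derive (fun t => cos (mu * (PI - 2 * t + Delta t))
                      + sin (mu * (PI - 2 * t + Delta t))) x
                    (- (mu * p) * (- sin y + cos y))).
    { apply (is_derive_comp (fun u => cos u + sin u)
        (fun t => mu * (PI - 2 * t + Delta t)) x (- sin y + cos y)); [|exact Hy].
      fold y. auto_derive; [exact I | ring]. }
    pose proof (is_derive_mult_R _ _ _ _ _
      (is_derive_mult_R _ _ _ _ _ Dq Hinv) Hcs) as H.
    apply (is_derive_scal _ x (/ (2 * mu))) in H.
    match type of H with is_derive _ _ ?l =>
      replace (_ - _) with l end.
    + apply is_derive_ext with (2 := H). intros t. unfold Rdiv.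
      apply Rmult_comm.
    + fold p y. cbv beta. fold p. unfold p in Hi. unfold p. field. lra.
Qed.

(** In the derivative of [U + V], the [J] term of [U] cancels the cosine part of the slow phase and
    [V] cancels the fast phase. The sine part of the slow phase carries the factor [c - s]; it stays
    on the right-hand side, to be removed once [c - s] is known to be small. *)
Lemma characteristic_residual (h1 h2 K mu : R)
    (q Delta dq dDelta ddDelta z w J : R -> R) :
  delay_data h1 h2 K q Delta dq dDelta ddDelta ->
  0 < mu -> 2 * (K * PI) <= mu ->
  reduced_solution h1 h2 q Delta mu z w -> z 0 = 1 ->
  continuity J ->
  (forall x, pieces h1 h2 x -> is_derive J x (q x * cos (mu * Delta x))) ->
  J 0 = 0 ->
  let c := cos (mu * PI) in let s := sin (mu * PI) in
  Rabs (c - s - (s + c) * ((1 + J PI / 2) / mu)) <=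
    (6 * K + 4 * K * PI + PI * (4 * K * K * PI + K + K * K)) / mu ^ 2
    + K * PI / 2 * Rabs (c - s) / mu.
Proof.
  intros D mu_pos mu_large S z0 Jc JD J0 c s.
  pose proof (dd_h _ _ _ _ _ _ _ _ D) as Hh.
  pose proof (dd_h2 _ _ _ _ _ _ _ _ D) as HP.
  pose proof (dd_K _ _ _ _ _ _ _ _ D) as K_ge0.
  pose proof PI_RGT_0 as PI_pos.
  assert (imu : 0 < / mu) by (apply Rinv_0_lt_compat; auto).
  assert (zM : forall x, 0 <= x <= PI -> Rabs (z x) <= 4).
  { intros x Hx. replace 4 with (4 * Rabs (z 0)) by (rewrite z0, Rabs_R1; ring).
    apply (solution_bound h1 h2 K mu q Delta dq dDelta ddDelta z w); auto. }
  set (g := - (mu * PI)).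
  set (U := fun t => z t * cos (mu * t + g) - w t * (sin (mu * t + g) / mu)
                     + (s + c) / (2 * mu) * J t).
  set (V := fun t => / mu * oscillation mu q Delta dDelta t).
  set (B := K / mu ^ 2).
  (* The three contributions: replacing [z (x - Delta x)] by the free solution with [M = 4], the
     remainder [e] of the oscillation, and the sine part of the slow phase. *)
  set (L := ((4 * K * K * PI + K + K * K) / mu + K / 2 * Rabs (c - s)) / mu).
  assert (HU : Rabs (U PI - U 0) <= 6 * B + L * PI).
  { apply (increment_bound h1 h2 B L PI U V); auto; try lra.
    - unfold B. apply Rmult_le_pos; [lra|].
      apply Rlt_le, Rinv_0_lt_compat, pow_lt. lra.
    - intros x. apply continuity_pt_plus.
      + apply continuity_pt_minus; apply continuity_pt_mult.
        * apply (rs_z_cont _ _ _ _ _ _ _ S).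
        * apply continuity_pt_filterlim.
          apply (ex_derive_continuous (fun x => cos (mu * x + g))).
          auto_derive. exact I.
        * apply (rs_w_cont _ _ _ _ _ _ _ S).
        * apply continuity_pt_filterlim.
          apply (ex_derive_continuous (fun x => sin (mu * x + g) / mu)).
          auto_derive. exact I.
      + apply (continuity_pt_scal J), Jc.
    - intros x Hx. unfold V, B. rewrite Rabs_mult, (Rabs_right (/ mu)) by lra.
      replace (K / mu ^ 2) with (/ mu * (K / mu)) by (field; lra).
      apply Rmult_le_compat_l; [lra|].
      apply (oscillation_bound h1 h2 K mu x q Delta dq dDelta ddDelta); auto.
    - intros x Hx.
      destruct (oscillation_derive h1 h2 K mu x q Delta dq dDelta ddDelta D mu_pos Hx)
        as [e [He De]].
      pose proof (rotated_derive h1 h2 mu g x q Delta z w ltac:(lra) S Hx) as Dr.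
      pose proof (is_derive_scal J x ((s + c) / (2 * mu)) _ (JD x Hx)) as DJ.
      pose proof (is_derive_plus _ _ _ _ _ (is_derive_plus _ _ _ _ _ Dr DJ)
        (is_derive_scal _ x (/ mu) _ De)) as H.
      eexists. split; [exact H|]. clear H Dr DJ De.
      change plus with Rplus.
      set (a := mu * (x - Delta x)). set (b := mu * x + g).
      assert (E1 : sin (mu * (PI - 2 * x + Delta x)) = - sin (a + b)).
      { rewrite <- sin_neg. f_equal. unfold a, b, g. ring. }
      assert (E2 : cos (mu * (PI - 2 * x + Delta x)) = cos (a + b)).
      { rewrite <- cos_neg. f_equal. unfold a, b, g. ring. }
      assert (E3 : sin (a - b) + cos (a - b) =
        (s + c) * cos (mu * Delta x) - (c - s) * sin (mu * Delta x)).
      { replace (a - b) with (mu * PI - mu * Delta x) by (unfold a, b, g; ring).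
        rewrite sin_minus, cos_minus. unfold s, c. ring. }
      pose proof (phase_product a b) as E4. rewrite E3 in E4.
      assert (Err : Rabs (z (x - Delta x) - (cos a - sin a)) <= K * 4 * PI / mu).
      { pose proof (dd_retard _ _ _ _ _ _ _ _ D x Hx) as R1.
        pose proof (dd_Delta_ge0 _ _ _ _ _ _ _ _ D x Hx) as R2.
        pose proof (solution_value h1 h2 K mu 4 (x - Delta x) q Delta dq dDelta ddDelta
          z w D mu_pos S zM) as H. rewrite z0, Rmult_1_l in H. apply H.
        unfold pieces in Hx. lra. }
      rewrite E1, E2.
      match goal with |- Rabs ?d <= _ => replace d with
        ((q x * (z (x - Delta x) - (cos a - sin a)) * sin b + e
         + / 2 * q x * (c - s) * sin (mu * Delta x)) / mu) end.
      (* The two sides differ by [q x / mu] times the product formula [E4], inserted here as a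
         zero. *)
      2: { rewrite <- (Rplus_0_r (_ / mu)).
        replace 0 with (q x / mu * ((cos a - sin a) * sin b - (- / 2 *
       ((s + c) * cos (mu * Delta x) - (c - s) * sin (mu * Delta x)) +
       / 2 * (sin (a + b) + cos (a + b))))) by (rewrite E4; ring).
        unfold b. field. lra. }
      unfold L. unfold Rdiv at 1. rewrite Rabs_mult, (Rabs_right (/ mu)) by lra.
      apply Rmult_le_compat_r; [lra|].
      assert (Hq := dd_q_le _ _ _ _ _ _ _ _ D x Hx).
      assert (Sin : forall y, Rabs (sin y) <= 1).
      { intros y. apply Rabs_le. pose proof (SIN_bound y). lra. }
      assert (T1 : Rabs (q x * (z (x - Delta x) - (cos a - sin a)) * sin b)
                   <= K * (K * 4 * PI / mu) * 1).
      { rewrite !Rabs_mult. apply Rmult_le_compat; try apply Rabs_pos; auto.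
        - apply Rmult_le_pos; apply Rabs_pos.
        - apply Rmult_le_compat; try apply Rabs_pos; auto. }
      assert (T2 : Rabs (/ 2 * q x * (c - s) * sin (mu * Delta x))
                   <= / 2 * K * Rabs (c - s) * 1).
      { rewrite !Rabs_mult, (Rabs_right (/ 2)) by lra.
        apply Rmult_le_compat; try apply Rabs_pos; auto.
        - repeat apply Rmult_le_pos; try apply Rabs_pos; lra.
        - apply Rmult_le_compat_r; [apply Rabs_pos|]. lra. }
      apply Rle_trans with (1 := Rabs_triang _ _).
      pose proof (Rabs_triang (q x * (z (x - Delta x) - (cos a - sin a)) * sin b) e).
      replace ((4 * K * K * PI + K + K * K) / mu + K / 2 * Rabs (c - s)) with
        (K * (K * 4 * PI / mu) * 1 + (K + K * K) / mu + / 2 * K * Rabs (c - s) * 1)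
        by (field; lra).
      lra. }
  assert (U0 : U 0 = c - s).
  { unfold U. rewrite J0, z0, (rs_0 _ _ _ _ _ _ _ S), z0, Rmult_0_r, Rplus_0_l.
    unfold g. rewrite cos_neg, sin_neg. fold c s. field. lra. }
  assert (UP : U PI = z PI + (s + c) / (2 * mu) * J PI).
  { unfold U, g. rewrite Rplus_opp_r, cos_0, sin_0. field. lra. }
  (* The condition at [PI] gives [z PI = - w PI / mu ^ 2], so the slope estimate determines [z PI]
     with one more power of [1 / mu]. *)
  assert (BC : Rabs (z PI - (s + c) / mu) <= 4 * K * PI / mu ^ 2).
  { pose proof (solution_slope h1 h2 K mu 4 PI q Delta dq dDelta ddDelta z w
      D mu_pos S zM ltac:(lra)) as H.
    rewrite z0, Rmult_1_l in H. fold c s in H.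
    pose proof (rs_PI _ _ _ _ _ _ _ S) as E.
    replace (z PI - (s + c) / mu) with (- / mu * (w PI / mu + (c + s))).
    - rewrite Rabs_mult, Rabs_Ropp, (Rabs_right (/ mu)) by lra.
      replace (4 * K * PI / mu ^ 2) with (/ mu * (K * 4 * PI / mu)) by (field; lra).
      apply Rmult_le_compat_l; lra.
    - replace (w PI) with (- mu ^ 2 * z PI) by lra. field. lra. }
  rewrite U0, UP in HU.
  replace (c - s - (s + c) * ((1 + J PI / 2) / mu)) with
    (- (z PI + (s + c) / (2 * mu) * J PI - (c - s)) + (z PI - (s + c) / mu))
    by (field; lra).
  apply Rle_trans with (1 := Rabs_triang _ _). rewrite Rabs_Ropp.
  replace ((6 * K + 4 * K * PI + PI * (4 * K * K * PI + K + K * K)) / mu ^ 2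
    + K * PI / 2 * Rabs (c - s) / mu) with
    (6 * B + L * PI + 4 * K * PI / mu ^ 2).
  - lra.
  - unfold B, L. field. lra.
Qed.


(** * Elementary estimates for sine and cosine *)

Lemma function_increment (f df : R -> R) (K u : R) :
  (forall t, is_derive f t (df t)) ->
  (forall t, Rabs t <= Rabs u -> Rabs (df t) <= K) ->
  Rabs (f u - f 0) <= K * Rabs u.
Proof.
  intros Hd HK. replace (Rabs u) with (Rabs (u - 0)) by (f_equal; ring).
  apply (bounded_variation f df K 0 u).
  intros t Ht. rewrite !Rminus_0_r in Ht. split; [apply Hd | apply HK, Ht].
Qed.

Lemma cos_lipschitz (x y : R) : Rabs (cos x - cos y) <= Rabs (x - y).
Proof.
  pose proof (function_increment (fun t => cos (y + t)) (fun t => - sin (y + t))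
    1 (x - y)) as H.
  cbv beta in H. rewrite Rplus_minus, Rplus_0_r, Rmult_1_l in H. apply H.
  - intros t. auto_derive; [exact I | ring].
  - intros t _. rewrite Rabs_Ropp. apply Rabs_le. pose proof (SIN_bound (y + t)). lra.
Qed.

Lemma cos_near_0 (u : R) : Rabs (1 - cos u) <= Rabs u.
Proof.
  rewrite <- cos_0. apply Rle_trans with (1 := cos_lipschitz _ _).
  rewrite Rminus_0_l, Rabs_Ropp. apply Rle_refl.
Qed.

(** A quadratic bound suffices, since it will be used with [u = O(1 / mu)] and an admissible error
    [O(1 / mu^2)]. *)
Lemma sin_near_0 (u : R) : Rabs (u - sin u) <= Rabs u * Rabs u.
Proof.
  pose proof (function_increment (fun t => t - sin t) (fun t => 1 - cos t) (Rabs u) u) as H.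
  cbv beta in H. rewrite sin_0, !Rminus_0_r in H. apply H.
  - intros t. auto_derive; [exact I | ring].
  - intros t Ht. apply Rle_trans with (1 := cos_near_0 t). exact Ht.
Qed.

(** The function [2 sin t - t] increases on this range, because [PI / 4 < PI / 3] makes
    [cos t >= 1 / 2]. The range is the window of the eigenvalue multiplied by [PI]. *)
Lemma sin_lower_bound (u : R) : Rabs u < PI / 4 -> Rabs u <= 2 * Rabs (sin u).
Proof.
  assert (P : forall v, 0 <= v < PI / 4 -> v <= 2 * sin v).
  { intros v Hv. pose proof PI_4 as P4.
    destruct (MVT_gen (fun t => 2 * sin t - t) 0 v (fun t => 2 * cos t - 1))
      as [c [Hc E]].
    - intros t _. auto_derive; [exact I | ring].
    - intros t _. apply continuity_pt_filterlim.
      apply (ex_derive_continuous (fun t => 2 * sin t - t)). auto_derive. exact I.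
    - rewrite Rmin_left, Rmax_right in Hc by lra.
      cbv beta in E. rewrite sin_0 in E.
      assert (Hcos : / 2 <= cos c).
      { rewrite <- Rdiv_1_l, <- cos_PI3. apply cos_decr_1; lra. }
      assert (0 <= (2 * cos c - 1) * (v - 0)) by (apply Rmult_le_pos; lra).
      lra. }
  intros Hu. destruct (Rle_dec 0 u) as [Hs | Hs].
  - rewrite (Rabs_right u) in * by lra.
    pose proof (P u ltac:(lra)). pose proof (Rle_abs (sin u)). lra.
  - rewrite (Rabs_left u) in * by lra.
    pose proof (P (- u) ltac:(lra)) as H. rewrite sin_neg in H.
    pose proof (Rle_abs (- sin u)) as H'. rewrite Rabs_Ropp in H'. lra.
Qed.

Lemma sin_INR_PI (n : nat) : sin (INR n * PI) = 0.
Proof.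
  induction n as [|n IH].
  - rewrite Rmult_0_l. apply sin_0.
  - rewrite S_INR, Rmult_plus_distr_r, Rmult_1_l, neg_sin, IH. ring.
Qed.

(** Sine and cosine coincide at [y = (n + 1/4) PI], so [k = 2 cos y] satisfies [k^2 = 2]. Only
    [1 <= Rabs k] is kept, which avoids tracking the sign [(-1)^n]. *)
Lemma cos_minus_sin_quarter (n : nat) (u : R) :
  exists k, 1 <= Rabs k /\
    cos ((INR n + 1 / 4) * PI + u) - sin ((INR n + 1 / 4) * PI + u) = - k * sin u /\
    sin ((INR n + 1 / 4) * PI + u) + cos ((INR n + 1 / 4) * PI + u) = k * cos u.
Proof.
  set (y := (INR n + 1 / 4) * PI).
  assert (E : cos y = cos (INR n * PI) * / sqrt 2 /\ sin y = cos (INR n * PI) * / sqrt 2).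
  { replace y with (INR n * PI + PI / 4) by (unfold y; field).
    rewrite cos_plus, sin_plus, sin_INR_PI, cos_PI4, sin_PI4. lra. }
  destruct E as [Ec Es].
  exists (2 * cos y). split; [|split].
  - pose proof (sin2_cos2 y) as P. rewrite Es, <- Ec in P. unfold Rsqr in P.
    rewrite <- (Rabs_R1). apply Rsqr_le_abs_0. unfold Rsqr. nra.
  - rewrite cos_plus, sin_plus, Es, Ec. ring.
  - rewrite cos_plus, sin_plus, Es, Ec. ring.
Qed.

Lemma Rdiv_le_div_pow (a m : R) : 0 <= a -> 1 <= m -> a / m ^ 2 <= a / m.
Proof.
  intros Ha Hm. apply Rmult_le_compat_l; [exact Ha|].
  apply Rinv_le_contravar; nra.
Qed.

(** * Uniform estimates and inversion of the characteristic equation *)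

Lemma antiderivative_bound (h1 h2 K m : R) (q Delta dq dDelta ddDelta J : R -> R) :
  delay_data h1 h2 K q Delta dq dDelta ddDelta ->
  continuity J ->
  (forall x, pieces h1 h2 x -> is_derive J x (q x * cos (m * Delta x))) ->
  J 0 = 0 -> Rabs (J PI) <= K * PI.
Proof.
  intros D Jc JD J0.
  rewrite <- (Rminus_0_r (J PI)), <- J0.
  pose proof PI_RGT_0.
  apply (increment_bound_simple h1 h2 K PI J (fun x => q x * cos (m * Delta x))).
  - apply (dd_h _ _ _ _ _ _ _ _ D).
  - apply (dd_h2 _ _ _ _ _ _ _ _ D).
  - exact Jc.
  - intros x Hx. split; [apply JD, Hx|].
    rewrite Rabs_mult, <- (Rmult_1_r K).
    apply Rmult_le_compat; try apply Rabs_pos.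
    + apply (dd_q_le _ _ _ _ _ _ _ _ D x Hx).
    + apply Rabs_le. pose proof (COS_bound (m * Delta x)). lra.
  - lra.
Qed.

(** This moves the frequency in the integral from the eigenvalue to [N + 1/4]. One factor [PI]
    bounds [Delta], the other is the length of the interval. *)
Lemma antiderivative_lipschitz (h1 h2 K m m' : R)
    (q Delta dq dDelta ddDelta J J' : R -> R) :
  delay_data h1 h2 K q Delta dq dDelta ddDelta ->
  continuity J -> continuity J' ->
  (forall x, pieces h1 h2 x -> is_derive J x (q x * cos (m * Delta x))) ->
  (forall x, pieces h1 h2 x -> is_derive J' x (q x * cos (m' * Delta x))) ->
  J 0 = 0 -> J' 0 = 0 ->
  Rabs (J PI - J' PI) <= K * PI * PI * Rabs (m - m').
Proof.
  intros D Jc Jc' JD JD' J0 J0'.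
  pose proof PI_RGT_0.
  replace (J PI - J' PI) with ((J PI - J' PI) - (J 0 - J' 0)) by lra.
  replace (K * PI * PI * Rabs (m - m')) with (K * (PI * Rabs (m - m')) * PI) by ring.
  apply (increment_bound_simple h1 h2 (K * (PI * Rabs (m - m'))) PI
    (fun x => J x - J' x)
    (fun x => q x * cos (m * Delta x) - q x * cos (m' * Delta x))).
  - apply (dd_h _ _ _ _ _ _ _ _ D).
  - apply (dd_h2 _ _ _ _ _ _ _ _ D).
  - intros x. apply (continuity_pt_minus J J'); auto.
  - intros x Hx. split.
    { apply (is_derive_minus J J'); auto. }
    rewrite <- Rmult_minus_distr_l, Rabs_mult.
    apply Rmult_le_compat; try apply Rabs_pos.
    { apply (dd_q_le _ _ _ _ _ _ _ _ D x Hx). }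
    pose proof (dd_retard _ _ _ _ _ _ _ _ D x Hx) as R1.
    pose proof (dd_Delta_ge0 _ _ _ _ _ _ _ _ D x Hx) as R2.
    assert (Dx : Delta x <= PI).
    { unfold pieces in Hx. pose proof (dd_h _ _ _ _ _ _ _ _ D).
      pose proof (dd_h2 _ _ _ _ _ _ _ _ D). lra. }
    apply Rle_trans with (1 := cos_lipschitz _ _).
    rewrite <- Rmult_minus_distr_r, Rabs_mult, (Rabs_right (Delta x)), Rmult_comm by lra.
    apply Rmult_le_compat_r; [apply Rabs_pos | exact Dx].
  - lra.
Qed.

(** A bootstrap: the crude bound [Rabs (c - s) <= 2] in the residual first gives
    [c - s = O(1 / mu)], and reinserting this makes the whole residual [O(1 / mu^2)]. *)
Lemma characteristic_asymptotics (K : R) :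
  0 <= K -> exists C, 0 <= C /\
  forall (h1 h2 mu : R) (q Delta dq dDelta ddDelta z w J : R -> R),
  delay_data h1 h2 K q Delta dq dDelta ddDelta ->
  1 <= mu -> 2 * (K * PI) <= mu ->
  reduced_solution h1 h2 q Delta mu z w -> z 0 = 1 ->
  continuity J ->
  (forall x, pieces h1 h2 x -> is_derive J x (q x * cos (mu * Delta x))) ->
  J 0 = 0 ->
  let c := cos (mu * PI) in let s := sin (mu * PI) in
  Rabs (c - s - (s + c) * ((1 + J PI / 2) / mu)) <= C / mu ^ 2.
Proof.
  intros K_ge0. pose proof PI_RGT_0 as PI_pos.
  set (C0 := 6 * K + 4 * K * PI + PI * (4 * K * K * PI + K + K * K)).
  set (C1 := K * PI / 2).
  assert (KP : 0 <= K * PI) by (apply Rmult_le_pos; lra).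
  assert (C0_ge0 : 0 <= C0) by (unfold C0; nra).
  assert (C1_ge0 : 0 <= C1) by (unfold C1; lra).
  (* The inner bracket is the constant of the first round, bounding [mu * Rabs (c - s)]. *)
  exists (C0 + C1 * (C0 + 2 * C1 + 2 * (1 + C1))). split; [nra|].
  intros h1 h2 mu q Delta dq dDelta ddDelta z w J D mu1 mu_large S z0 Jc JD J0 c s.
  pose proof (characteristic_residual h1 h2 K mu q Delta dq dDelta ddDelta z w J
    D ltac:(lra) mu_large S z0 Jc JD J0) as H.
  cbv zeta in H. fold c s in H. fold C0 C1 in H.
  pose proof (antiderivative_bound h1 h2 K mu q Delta dq dDelta ddDelta J D Jc JD J0) as JB.
  assert (imu : 0 < / mu) by (apply Rinv_0_lt_compat; lra).
  set (X := c - s - (s + c) * ((1 + J PI / 2) / mu)) in *.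
  assert (cs2 : Rabs (c - s) <= 2).
  { unfold c, s. apply Rabs_le. pose proof (COS_bound (mu * PI)).
    pose proof (SIN_bound (mu * PI)). lra. }
  assert (L : Rabs ((s + c) * ((1 + J PI / 2) / mu)) <= 2 * (1 + C1) / mu).
  { unfold Rdiv at 1. rewrite !Rabs_mult, (Rabs_right (/ mu)) by lra.
    replace (2 * (1 + C1) / mu) with (2 * ((1 + C1) * / mu)) by (field; lra).
    apply Rmult_le_compat; try apply Rabs_pos.
    - apply Rmult_le_pos; [apply Rabs_pos | lra].
    - rewrite Rplus_comm. apply cos_plus_sin_bound.
    - apply Rmult_le_compat_r; [lra|]. unfold C1.
      apply Rabs_le_between in JB. apply Rabs_le. lra. }
  assert (cs : Rabs (c - s) <= (C0 + 2 * C1 + 2 * (1 + C1)) / mu).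
  { replace (c - s) with (X + (s + c) * ((1 + J PI / 2) / mu)) by (unfold X; ring).
    apply Rle_trans with (1 := Rabs_triang _ _).
    assert (A1 : C0 / mu ^ 2 <= C0 / mu) by (apply Rdiv_le_div_pow; auto).
    assert (A2 : C1 * Rabs (c - s) / mu <= C1 * 2 / mu).
    { apply Rmult_le_compat_r; [lra|]. apply Rmult_le_compat_l; auto. }
    replace ((C0 + 2 * C1 + 2 * (1 + C1)) / mu) with
      (C0 / mu + C1 * 2 / mu + 2 * (1 + C1) / mu) by (field; lra).
    lra. }
  apply Rle_trans with (1 := H).
  replace ((C0 + C1 * (C0 + 2 * C1 + 2 * (1 + C1))) / mu ^ 2) with
    (C0 / mu ^ 2 + C1 * ((C0 + 2 * C1 + 2 * (1 + C1)) / mu) / mu) by (field; lra).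
  apply Rplus_le_compat_l. apply Rmult_le_compat_r; [lra|].
  apply Rmult_le_compat_l; auto.
Qed.

(** With [u = PI * (mu - (n + 1/4))] the hypothesis, divided by [Rabs k >= 1], says that
    [sin u + cos u * L] is small. First [u = O(1 / mu)] follows from [sin_lower_bound]; then [sin u]
    and [cos u] are replaced by [u] and [1] at the cost of [O(1 / mu^2)]. *)
Lemma quarter_inversion (A B : R) : 0 <= A -> 0 <= B ->
  exists C, 0 <= C /\ forall (n : nat) (mu L : R),
  Rabs (INR n + 1 / 4 - mu) < 1 / 4 -> 1 <= mu ->
  Rabs L <= B / mu ->
  let c := cos (mu * PI) in let s := sin (mu * PI) in
  Rabs (c - s - (s + c) * L) <= A / mu ^ 2 ->
  Rabs (mu - (INR n + 1 / 4)) <= C / mu /\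
  Rabs (PI * (mu - (INR n + 1 / 4)) + L) <= C / mu ^ 2.
Proof.
  intros A_ge0 B_ge0.
  (* This bounds [mu * Rabs u]; the factor [2] comes from [sin_lower_bound]. *)
  set (G := 2 * (A + B)).
  exists (G + (A + G * G + G * B)).
  assert (G_ge0 : 0 <= G) by (unfold G; lra).
  assert (GG : 0 <= G * G) by (apply Rmult_le_pos; lra).
  assert (GB : 0 <= G * B) by (apply Rmult_le_pos; lra).
  split; [lra|].
  intros n mu L Hmu mu1 HL c s H.
  pose proof PI_RGT_0 as PI_pos.
  assert (PI1 : 1 <= PI) by (pose proof PI2_1; lra).
  assert (imu : 0 < / mu) by (apply Rinv_0_lt_compat; lra).
  set (v := mu - (INR n + 1 / 4)).
  set (u := PI * v).
  assert (Hu : Rabs u < PI / 4).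
  { unfold u, v. rewrite Rabs_mult, (Rabs_right PI), Rabs_minus_sym by lra.
    apply Rlt_le_trans with (PI * (1 / 4)); [|lra].
    apply Rmult_lt_compat_l; lra. }
  destruct (cos_minus_sin_quarter n u) as [k [Hk [E1 E2]]].
  replace ((INR n + 1 / 4) * PI + u) with (mu * PI) in E1, E2 by (unfold u, v; ring).
  fold c s in E1, E2. rewrite E1, E2 in H.
  assert (H' : Rabs (sin u + cos u * L) <= A / mu ^ 2).
  { apply Rle_trans with (2 := H).
    replace (- k * sin u - k * cos u * L) with (- k * (sin u + cos u * L)) by ring.
    rewrite Rabs_mult, Rabs_Ropp.
    rewrite <- (Rmult_1_l (Rabs (sin u + cos u * L))) at 1.
    apply Rmult_le_compat_r; [apply Rabs_pos | exact Hk]. }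
  assert (cL : Rabs (cos u * L) <= B / mu).
  { rewrite Rabs_mult, <- (Rmult_1_l (B / mu)).
    apply Rmult_le_compat; try apply Rabs_pos; auto.
    apply Rabs_le. pose proof (COS_bound u). lra. }
  assert (uG : Rabs u <= G / mu).
  { apply Rle_trans with (1 := sin_lower_bound u Hu).
    replace (sin u) with ((sin u + cos u * L) + - (cos u * L)) by ring.
    pose proof (Rabs_triang (sin u + cos u * L) (- (cos u * L))) as T.
    rewrite Rabs_Ropp in T.
    pose proof (Rdiv_le_div_pow A mu A_ge0 mu1).
    replace (G / mu) with (2 * (A / mu + B / mu)) by (unfold G; field; lra). lra. }
  split.
  - apply Rle_trans with (Rabs u).
    + unfold u. rewrite Rabs_mult, (Rabs_right PI) by lra.
      pose proof (Rabs_pos v). nra.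
    + apply Rle_trans with (1 := uG). apply Rmult_le_compat_r; lra.
  - replace (u + L) with ((sin u + cos u * L) + ((u - sin u) + (1 - cos u) * L)) by ring.
    apply Rle_trans with (1 := Rabs_triang _ _).
    pose proof (Rabs_triang (u - sin u) ((1 - cos u) * L)) as T.
    assert (T1 : Rabs (u - sin u) <= G / mu * (G / mu)).
    { apply Rle_trans with (1 := sin_near_0 u).
      apply Rmult_le_compat; auto; apply Rabs_pos. }
    assert (T2 : Rabs ((1 - cos u) * L) <= G / mu * (B / mu)).
    { rewrite Rabs_mult. apply Rmult_le_compat; try apply Rabs_pos; auto.
      apply Rle_trans with (1 := cos_near_0 u). exact uG. }
    assert (T3 : 0 <= G / mu ^ 2).
    { apply Rmult_le_pos; [lra|]. apply Rlt_le, Rinv_0_lt_compat, pow_lt. lra. }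
    replace ((G + (A + G * G + G * B)) / mu ^ 2) with
      (G / mu ^ 2 + A / mu ^ 2 + G / mu * (G / mu) + G / mu * (B / mu)) by (field; lra).
    lra.
Qed.

(** The inversion gives [PI * v = - L] up to [O(1 / mu^2)], where [L] still contains the unknown
    [mu] in its denominator and in its integral. Since [v = O(1 / mu)], replacing [mu] by [N + 1/4]
    in both places stays within the error. *)
Lemma eigenvalue_asymptotics (K : R) :
  0 <= K -> exists C, 0 <= C /\
  forall (n : nat) (h1 h2 mu : R) (q Delta dq dDelta ddDelta z w J J0 : R -> R),
  delay_data h1 h2 K q Delta dq dDelta ddDelta ->
  Rabs (INR n + 1 / 4 - mu) < 1 / 4 ->
  1 <= INR n -> 2 * (K * PI) <= INR n ->
  reduced_solution h1 h2 q Delta mu z w -> z 0 = 1 ->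
  continuity J -> continuity J0 ->
  (forall x, pieces h1 h2 x -> is_derive J x (q x * cos (mu * Delta x))) ->
  (forall x, pieces h1 h2 x ->
     is_derive J0 x (q x * cos ((INR n + 1 / 4) * Delta x))) ->
  J 0 = 0 -> J0 0 = 0 ->
  Rabs (mu - (INR n + 1 / 4 - 2 / (PI * (4 * INR n + 1)) * (2 + J0 PI)))
    <= C / INR n ^ 2.
Proof.
  intros K_ge0. pose proof PI_RGT_0 as PI_pos.
  assert (PI1 : 1 <= PI) by (pose proof PI2_1; lra).
  assert (KP : 0 <= K * PI) by (apply Rmult_le_pos; lra).
  destruct (characteristic_asymptotics K K_ge0) as [A [A_ge0 HA]].
  set (B := 1 + K * PI / 2).
  assert (B_ge0 : 0 <= B) by (unfold B; lra).
  destruct (quarter_inversion A B A_ge0 B_ge0) as [C [C_ge0 HC]].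
  set (E := K * PI * PI).
  assert (E_ge0 : 0 <= E) by (unfold E; apply Rmult_le_pos; lra).
  assert (BC : 0 <= B * C) by (apply Rmult_le_pos; lra).
  assert (EC : 0 <= E * C) by (apply Rmult_le_pos; lra).
  exists (C + B * C + E * C). split; [lra|].
  intros n h1 h2 mu q Delta dq dDelta ddDelta z w J J0 D Hmu n1 n_large S z0
    Jc J0c JD J0D J00 J000.
  assert (mun : INR n <= mu) by (apply Rabs_def2 in Hmu; lra).
  assert (mu1 : 1 <= mu) by lra.
  assert (imu : 0 < / mu) by (apply Rinv_0_lt_compat; lra).
  pose proof (HA h1 h2 mu q Delta dq dDelta ddDelta z w J D mu1 ltac:(lra) S z0
    Jc JD J00) as H. cbv zeta in H.
  assert (JB := antiderivative_bound h1 h2 K mu q Delta dq dDelta ddDelta J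
    D Jc JD J00).
  assert (JB0 := antiderivative_bound h1 h2 K (INR n + 1 / 4) q Delta dq dDelta ddDelta
    J0 D J0c J0D J000).
  assert (Bnd : forall y, Rabs y <= K * PI -> Rabs (1 + y / 2) <= B).
  { intros y Hy. unfold B. apply Rabs_le_between in Hy. apply Rabs_le. lra. }
  set (L := (1 + J PI / 2) / mu) in *.
  assert (HL : Rabs L <= B / mu).
  { unfold L, Rdiv at 1. rewrite Rabs_mult, (Rabs_right (/ mu)) by lra.
    apply Rmult_le_compat_r; [lra | apply Bnd, JB]. }
  destruct (HC n mu L Hmu mu1 HL H) as [Hv HvL].
  set (N := INR n + 1 / 4) in *.
  assert (JL := antiderivative_lipschitz h1 h2 K N mu q Delta dq dDelta ddDelta J0 J
    D J0c Jc J0D JD J000 J00). fold E in JL.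
  rewrite Rabs_minus_sym in JL. rewrite (Rabs_minus_sym N mu) in JL.
  set (v := mu - N) in *.
  (* As [4 * INR n + 1 = 4 * N], the main correction is [(1 + J0 PI / 2) / (PI * N)]. The two extra
     terms come from [1 / N - 1 / mu = v / (N * mu)] and from exchanging [J] for [J0]. *)
  assert (E1 : mu - (N - 2 / (PI * (4 * INR n + 1)) * (2 + J0 PI)) =
    / PI * ((PI * v + L) + ((1 + J0 PI / 2) * v * / N * / mu
                            + - (/ 2 * (J PI - J0 PI) * / mu)))).
  { unfold v, L. replace (INR n) with (N - 1 / 4) by (unfold N; ring).
    field. unfold N. repeat split; lra. }
  rewrite E1.
  assert (iN : 0 < / N <= 1).
  { unfold N. split; [apply Rinv_0_lt_compat; lra|]. rewrite <- Rinv_1 at 2.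
    apply Rinv_le_contravar; lra. }
  assert (iPI : 0 < / PI <= 1).
  { split; [apply Rinv_0_lt_compat; lra|]. rewrite <- Rinv_1.
    apply Rinv_le_contravar; lra. }
  rewrite Rabs_mult, (Rabs_right (/ PI)) by lra.
  assert (T1 : Rabs ((1 + J0 PI / 2) * v * / N * / mu) <= B * (C / mu) * 1 * / mu).
  { rewrite !Rabs_mult, (Rabs_right (/ mu)), (Rabs_right (/ N)) by lra.
    apply Rmult_le_compat_r; [lra|].
    apply Rmult_le_compat; [apply Rmult_le_pos; apply Rabs_pos | lra | | lra].
    apply Rmult_le_compat; try apply Rabs_pos; [apply Bnd, JB0 | exact Hv]. }
  assert (T2 : Rabs (- (/ 2 * (J PI - J0 PI) * / mu)) <= 1 * (E * (C / mu)) * / mu).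
  { rewrite Rabs_Ropp, !Rabs_mult, (Rabs_right (/ mu)), (Rabs_right (/ 2)) by lra.
    apply Rmult_le_compat_r; [lra|].
    apply Rmult_le_compat; [lra | apply Rabs_pos | lra |].
    apply Rle_trans with (1 := JL). apply Rmult_le_compat_l; auto. }
  assert (T3 := Rabs_triang (PI * v + L) ((1 + J0 PI / 2) * v * / N * / mu
                            + - (/ 2 * (J PI - J0 PI) * / mu))).
  assert (T4 := Rabs_triang ((1 + J0 PI / 2) * v * / N * / mu)
                            (- (/ 2 * (J PI - J0 PI) * / mu))).
  apply Rle_trans with ((C + B * C + E * C) / mu ^ 2).
  - replace ((C + B * C + E * C) / mu ^ 2) with
      (1 * (C / mu ^ 2 + B * (C / mu) * 1 * / mu + 1 * (E * (C / mu)) * / mu))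
      by (field; lra).
    apply Rmult_le_compat; [lra | apply Rabs_pos | lra | lra].
  - apply Rmult_le_compat_l; [lra|]. apply Rinv_le_contravar; nra.
Qed.


(** * Return to problem (P) and conclusion *)

Lemma limit1_in_comp (g f : R -> R) (D : R -> Prop) (l a : R) :
  continuity_pt g l -> limit1_in f D l a -> limit1_in (fun x => g (f x)) D (g l) a.
Proof.
  intros gc H eps eps_pos.
  destruct (gc eps eps_pos) as [b [b_pos Hb]].
  destruct (H b b_pos) as [alp [alp_pos Ha]].
  exists alp. split; [exact alp_pos|]. intros x Hx.
  (* Continuity at [l] speaks only of points different from [l], so the case [f x = l] is
     separate. *)
  destruct (Req_dec (f x) l) as [-> | Hne].
  - simpl. rewrite Rdist_eq. exact eps_pos.
  - apply Hb. split.
    + split; [exact I | intros E; apply Hne; symmetry; exact E].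
    + apply Ha, Hx.
Qed.

Lemma limit1_in_mult_cos (q Delta : R -> R) (D : R -> Prop) (m l l' a : R) :
  limit1_in q D l a -> limit1_in Delta D l' a ->
  limit1_in (fun x => q x * cos (m * Delta x)) D (l * cos (m * l')) a.
Proof.
  intros Hq HD. apply (limit_mul q (fun x => cos (m * Delta x))); [exact Hq|].
  apply (limit1_in_comp (fun d => cos (m * d)) Delta); [|exact HD].
  apply continuity_pt_filterlim.
  apply (ex_derive_continuous (fun d => cos (m * d))). auto_derive. exact I.
Qed.

Lemma mult_cos_antiderivative (h1 h2 m : R) (q Delta : R -> R) :
  0 < h1 < h2 -> h2 < PI ->
  (forall x, dom h1 h2 x -> continue_in q (dom h1 h2) x) ->
  has_one_sided_lims q h1 -> has_one_sided_lims q h2 ->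
  (forall x, dom h1 h2 x -> continue_in Delta (dom h1 h2) x) ->
  has_one_sided_lims Delta h1 -> has_one_sided_lims Delta h2 ->
  exists J, continuity J /\
    (forall x, pieces h1 h2 x -> is_derive J x (q x * cos (m * Delta x))) /\
    J 0 = 0 /\ J PI = RInt (fun x => q x * cos (m * Delta x)) 0 PI.
Proof.
  intros Hh HP qc [[ql1 QL1] [qr1 QR1]] [[ql2 QL2] [qr2 QR2]]
    Dc [[dl1 DL1] [dr1 DR1]] [[dl2 DL2] [dr2 DR2]].
  apply piecewise_antiderivative; auto.
  - intros x Hx. apply limit1_in_mult_cos; [apply qc | apply Dc]; exact Hx.
  - split; eexists; apply limit1_in_mult_cos; eassumption.
  - split; eexists; apply limit1_in_mult_cos; eassumption.
Qed.

Lemma continuity_bounded (g : R -> R) (a b : R) :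
  a <= b -> continuity g -> exists M, forall x, a <= x <= b -> Rabs (g x) <= M.
Proof.
  intros ab gc.
  destruct (continuity_ab_maj (fun x => Rabs (g x)) a b ab) as [m [Hm _]].
  - intros x _. apply (continuity_pt_comp g Rabs); [apply gc | apply Rcontinuity_abs].
  - exists (Rabs (g m)). exact Hm.
Qed.

(** Compactness of [[0, PI]] bounds each continuous extension; this supplies the bound on [q], which
    is not among the assumptions. *)
Lemma piecewise_bounded (h1 h2 : R) (f : R -> R) :
  0 < h1 < h2 -> h2 < PI ->
  (forall x, dom h1 h2 x -> continue_in f (dom h1 h2) x) ->
  has_one_sided_lims f h1 -> has_one_sided_lims f h2 ->
  bounded_on (dom h1 h2) f.
Proof.
  intros Hh HP fc [[l1 L1] [r1 R1]] [[l2 L2] [r2 R2]].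
  destruct (piecewise_extension h1 h2 f l1 r1 l2 r2 Hh HP fc L1 R1 L2 R2)
    as [g1 [g2 [g3 [[c1 [_ e1]] [[c2 [_ [_ e2]]] [c3 [_ e3]]]]]]].
  destruct (continuity_bounded g1 0 PI) as [M1 B1]; [lra | exact c1 |].
  destruct (continuity_bounded g2 0 PI) as [M2 B2]; [lra | exact c2 |].
  destruct (continuity_bounded g3 0 PI) as [M3 B3]; [lra | exact c3 |].
  exists (Rmax M1 (Rmax M2 M3)). intros x [Hx | [Hx | Hx]].
  - rewrite <- e1 by lra. apply Rle_trans with M1; [apply B1; lra | apply Rmax_l].
  - rewrite <- e2 by lra. apply Rle_trans with M2; [apply B2; lra|].
    apply Rle_trans with (2 := Rmax_r _ _). apply Rmax_l.
  - rewrite <- e3 by lra. apply Rle_trans with M3; [apply B3; lra|].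
    apply Rle_trans with (2 := Rmax_r _ _). apply Rmax_r.
Qed.

Lemma reduced_solution_scal (h1 h2 mu k : R) (q Delta z w : R -> R) :
  reduced_solution h1 h2 q Delta mu z w ->
  reduced_solution h1 h2 q Delta mu (fun x => k * z x) (fun x => k * w x).
Proof.
  intros [zc wc Hz Hw H0 HP]. split.
  - intros x. apply (continuity_pt_scal z), zc.
  - intros x. apply (continuity_pt_scal w), wc.
  - intros x Hx. apply is_derive_scal, Hz, Hx.
  - intros x Hx.
    replace (- q x * (k * z (x - Delta x)) - mu ^ 2 * (k * z x))
      with (k * (- q x * z (x - Delta x) - mu ^ 2 * z x)) by ring.
    apply is_derive_scal, Hw, Hx.
  - rewrite H0. ring.
  - replace (mu ^ 2 * (k * z PI) + k * w PI) with (k * (mu ^ 2 * z PI + w PI)) by ring.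
    rewrite HP. ring.
Qed.

(* Multiplying [y] by [1], [delta] and [delta * theta] on the successive pieces
   turns the transmission conditions into continuity; since the retarded
   argument never leaves its piece, the equation is unchanged. *)
Lemma solution_reduced (h1 h2 delta theta mu : R) (q Delta y : R -> R) :
  0 < h1 < h2 -> h2 < PI -> delta <> 0 -> theta <> 0 ->
  (forall x, dom h1 h2 x -> 0 <= Delta x) ->
  (forall x, 0 <= x < h1 -> 0 <= x - Delta x) ->
  (forall x, h1 < x < h2 -> h1 <= x - Delta x) ->
  (forall x, h2 < x < PI -> h2 <= x - Delta x) ->
  is_solution h1 h2 delta theta q Delta mu y ->
  (exists x, dom h1 h2 x /\ y x <> 0) ->
  exists z w, reduced_solution h1 h2 q Delta mu z w /\
    exists x, 0 <= x <= PI /\ z x <> 0.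
Proof.
  intros Hh HP delta0 theta0 D0 Ret1 Ret2 Ret3
    [Y [dy [ddy [[YE [Y1 Y2]] [Dy [Ddy [Eq [BC0 [BCP [T1 [T1' [T2 T2']]]]]]]]]]]]
    [x0 [Dx0 Nx0]].
  destruct (transmission_glue h1 h2 delta theta y Hh HP
    (fun x Hx => cont_deriv _ _ _ _ (Dy x Hx)) T1 T2)
    as [z [zc [z1 [z2 [z3 [zh1 zh2]]]]]].
  destruct (transmission_glue h1 h2 delta theta dy Hh HP
    (fun x Hx => cont_deriv _ _ _ _ (Ddy x Hx)) T1' T2')
    as [w [wc [w1 [w2 [w3 _]]]]].
  (* Used with [k] equal to [1], [delta] and [delta * theta]. The half-open range for [Y] covers a
     retarded argument that meets the left endpoint. *)
  assert (Piece : forall k a b x, a < x < b ->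
    (forall t, a < t < b -> z t = k * y t /\ w t = k * dy t) ->
    (forall t, a <= t < b -> z t = k * Y t) ->
    a <= x - Delta x -> pieces h1 h2 x ->
    is_derive z x (w x) /\
    is_derive w x (- q x * z (x - Delta x) - mu ^ 2 * z x)).
  { intros k a b x Hx E EY Hr Px.
    pose proof (pieces_dom _ _ _ Px) as Dx.
    pose proof (D0 x Dx) as Dg.
    split.
    - rewrite (proj2 (E x Hx)).
      apply (is_derive_ext_interval (fun t => k * y t) z a b); auto.
      + intros t Ht. rewrite (proj1 (E t Ht)). reflexivity.
      + apply is_derive_scal. apply (D_in_pieces h1 h2); auto.
    - rewrite EY, (proj1 (E x Hx)) by lra.
      pose proof (Eq x Dx) as Ex.
      replace (- q x * (k * Y (x - Delta x)) - mu ^ 2 * (k * y x)) with (k * ddy x).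
      2: { replace (ddy x) with (- q x * Y (x - Delta x) - mu ^ 2 * y x) by lra. ring. }
      apply (is_derive_ext_interval (fun t => k * dy t) w a b); auto.
      + intros t Ht. rewrite (proj2 (E t Ht)). reflexivity.
      + apply is_derive_scal. apply (D_in_pieces h1 h2); auto. }
  assert (ODE : forall x, pieces h1 h2 x -> is_derive z x (w x) /\
    is_derive w x (- q x * z (x - Delta x) - mu ^ 2 * z x)).
  { intros x Px. pose proof Px as [Hx | [Hx | Hx]].
    - apply (Piece 1 0 h1); auto.
      + intros t Ht. rewrite z1, w1 by lra. lra.
      + intros t Ht. rewrite z1, YE by lra. lra.
      + apply Ret1. lra.
    - apply (Piece delta h1 h2); auto.
      intros t Ht. destruct (Req_dec t h1) as [-> | Hne]; [apply zh1, Y1|].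
      rewrite z2, YE by lra. reflexivity.
    - apply (Piece (delta * theta) h2 PI); auto.
      + intros t Ht. rewrite z3, w3 by lra. split; reflexivity.
      + intros t Ht. destruct (Req_dec t h2) as [-> | Hne]; [apply zh2, Y2|].
        rewrite z3, YE by lra. reflexivity. }
  exists z, w. split.
  - split; auto.
    + intros x Hx. apply ODE, Hx.
    + intros x Hx. apply ODE, Hx.
    + rewrite z1, w1 by lra. lra.
    + rewrite z3, w3 by lra.
      replace (_ + _) with (delta * theta * (mu ^ 2 * y PI + dy PI)) by ring.
      rewrite BCP. ring.
  - exists x0. split; [unfold dom in Dx0; lra|].
    destruct Dx0 as [H | [H | H]].
    + rewrite z1 by lra. exact Nx0.
    + rewrite z2 by lra. apply Rmult_integral_contrapositive_currified; auto.
    + rewrite z3 by lra. repeat apply Rmult_integral_contrapositive_currified; auto.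
Qed.

(** If [z 0] vanished, [solution_bound] would force [z = 0] on [[0, PI]]; hence division by [z 0] is
    possible. *)
Lemma reduced_solution_normalized (h1 h2 K mu : R)
    (q Delta dq dDelta ddDelta z w : R -> R) :
  delay_data h1 h2 K q Delta dq dDelta ddDelta ->
  0 < mu -> 2 * (K * PI) <= mu ->
  reduced_solution h1 h2 q Delta mu z w ->
  (exists x, 0 <= x <= PI /\ z x <> 0) ->
  exists z1 w1, reduced_solution h1 h2 q Delta mu z1 w1 /\ z1 0 = 1.
Proof.
  intros D mu_pos mu_large S [x [Hx Nx]].
  assert (N0 : z 0 <> 0).
  { intros E. apply Nx.
    pose proof (solution_bound h1 h2 K mu q Delta dq dDelta ddDelta z w
      D mu_pos mu_large S x Hx) as H.
    rewrite E, Rabs_R0, Rmult_0_r in H. apply Rabs_eq_0.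
    apply Rle_antisym; [exact H | apply Rabs_pos]. }
  exists (fun t => / z 0 * z t), (fun t => / z 0 * w t). split.
  - apply reduced_solution_scal, S.
  - apply Rinv_l, N0.
Qed.

Theorem theorem3p3 (h1 h2 delta theta : R) (q Delta : R -> R)
  (h1_pos : 0 < h1) (h1_lt_h2 : h1 < h2) (h2_lt_PI : h2 < PI)
  (delta_neq0 : delta <> 0) (theta_neq0 : theta <> 0)
  (q_cont : forall x, dom h1 h2 x -> continue_in q (dom h1 h2) x)
  (q_lims1 : has_one_sided_lims q h1) (q_lims2 : has_one_sided_lims q h2)
  (Delta_cont : forall x, dom h1 h2 x -> continue_in Delta (dom h1 h2) x)
  (Delta_lims1 : has_one_sided_lims Delta h1)
  (Delta_lims2 : has_one_sided_lims Delta h2)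
  (Delta_ge0 : forall x, dom h1 h2 x -> 0 <= Delta x)
  (retard1 : forall x, 0 <= x < h1 -> 0 <= x - Delta x)
  (retard2 : forall x, h1 < x < h2 -> h1 <= x - Delta x)
  (retard3 : forall x, h2 < x < PI -> h2 <= x - Delta x)
  (dq dDelta ddDelta : R -> R)
  (q_deriv : forall x, dom h1 h2 x -> D_in q dq (dom h1 h2) x)
  (Delta_deriv : forall x, dom h1 h2 x -> D_in Delta dDelta (dom h1 h2) x)
  (Delta_deriv2 : forall x, dom h1 h2 x -> D_in dDelta ddDelta (dom h1 h2) x)
  (dq_bounded : bounded_on (dom h1 h2) dq)
  (ddDelta_bounded : bounded_on (dom h1 h2) ddDelta)
  (dq_lims1 : has_one_sided_lims dq h1) (dq_lims2 : has_one_sided_lims dq h2)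
  (ddDelta_lims1 : has_one_sided_lims ddDelta h1)
  (ddDelta_lims2 : has_one_sided_lims ddDelta h2)
  (dDelta_le1 : forall x, dom h1 h2 x -> dDelta x <= 1)
  (Delta_0 : Delta 0 = 0)
  (Delta_h1 : right_lim Delta h1 0) (Delta_h2 : right_lim Delta h2 0)
  (mu : nat -> R)
  (mu_def : eventually (fun N =>
     unique (fun m => is_eigenvalue h1 h2 delta theta q Delta m /\
                      Rabs (INR N + 1 / 4 - m) < 1 / 4) (mu N))) :
  exists C : R, eventually (fun N =>
    Rabs (mu N -
          (INR N + 1 / 4 -
           2 / (PI * (4 * INR N + 1)) *
           (2 + RInt (fun tau => q tau * cos ((INR N + 1 / 4) * Delta tau))
                     0 PI)))
    <= C / (INR N) ^ 2).
Proof.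
  assert (Hh : 0 < h1 < h2) by lra.
  destruct (piecewise_bounded h1 h2 q Hh h2_lt_PI q_cont q_lims1 q_lims2) as [M1 B1].
  destruct dq_bounded as [M2 B2]. destruct ddDelta_bounded as [M3 B3].
  set (K := Rmax M1 (Rmax M2 M3)).
  assert (K1 : M1 <= K) by apply Rmax_l.
  assert (K2 : M2 <= K) by (apply Rle_trans with (2 := Rmax_r _ _), Rmax_l).
  assert (K3 : M3 <= K) by (apply Rle_trans with (2 := Rmax_r _ _), Rmax_r).
  assert (K_ge0 : 0 <= K).
  { apply Rle_trans with (2 := K1). apply Rle_trans with (1 := Rabs_pos (q 0)).
    apply B1. left. lra. }
  assert (Data : delay_data h1 h2 K q Delta dq dDelta ddDelta).
  { split; auto; intros x Px; pose proof (pieces_dom _ _ _ Px) as Dx;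
      try (apply (D_in_pieces h1 h2); auto; fail); auto.
    - apply Rle_trans with (2 := K1). auto.
    - apply Rle_trans with (2 := K2). auto.
    - apply Rle_trans with (2 := K3). auto.
    - destruct Px as [Hx | [Hx | Hx]].
      + apply retard1. lra.
      + pose proof (retard2 x Hx). lra.
      + pose proof (retard3 x Hx). lra. }
  destruct (eigenvalue_asymptotics K K_ge0) as [C [_ HC]].
  destruct mu_def as [n0 Hn0].
  (* Beyond this index both [1 <= INR n] and [2 * (K * PI) <= INR n] hold. *)
  destruct (INR_unbounded (1 + 2 * (K * PI))) as [n1 Hn1].
  assert (KP : 0 <= K * PI) by (apply Rmult_le_pos; pose proof PI_RGT_0; lra).
  exists C, (max n0 n1). intros n Hn.
  destruct (Hn0 n) as [[[mu_pos [y [Sol Ny]]] Hmu] _];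
    [apply Nat.le_trans with (2 := Hn), Nat.le_max_l|].
  assert (n_large : INR n1 <= INR n)
    by (apply le_INR, Nat.le_trans with (2 := Hn), Nat.le_max_r).
  assert (mu_large : INR n <= mu n) by (apply Rabs_def2 in Hmu; lra).
  destruct (solution_reduced h1 h2 delta theta (mu n) q Delta y) as [z [w [S Nz]]];
    auto.
  destruct (reduced_solution_normalized h1 h2 K (mu n) q Delta dq dDelta ddDelta z w
    Data mu_pos ltac:(lra) S Nz) as [z1 [w1 [S1 z10]]].
  (* Two antiderivatives occur: frequency [mu n] for the characteristic equation, and
     [INR n + 1 / 4] for the integral in the statement. *)
  destruct (mult_cos_antiderivative h1 h2 (mu n) q Delta)
    as [J [Jc [JD [J0 _]]]]; auto.
  destruct (mult_cos_antiderivative h1 h2 (INR n + 1 / 4) q Delta)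
    as [JN [JNc [JND [JN0 JNP]]]]; auto.
  rewrite <- JNP.
  apply (HC n h1 h2 (mu n) q Delta dq dDelta ddDelta z1 w1 J JN); auto; lra.
Qed.
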